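(* Let $N\ge 2$ and let $W$ be one of the weight matrices $W_H$, $W_L$ or $W_J$ of size $N\times N$ defined in the context. Then: (i) $W$ is a solution to the Matrix Bochner Problem, i.e. the algebra $\mathcal D(W)$ contains a differential operator of order exactly $2$; (ii) $W$ is not a Darboux transformation of any direct sum $w_1\oplus\cdots\oplus w_N$ of classical scalar weights.
   Context: A weight matrix of size $N$ is a smooth function $W$ on an interval $(x_0,x_1)$ with values in $N\times N$ complex matrices, positive definite almost everywhere, with finite moments of all orders; it defines $\langle P,Q\rangle_W=\int_{x_0}^{x_1}P(x)W(x)Q(x)^*dx$ on matrix polynomials $\mathrm{Mat}_N(\mathbb C[x])$, and there is a unique sequence $(P_n)_{n\ge0}$ of monic orthogonal matrix polynomials ($\deg P_n=n$, leading coefficient $I$, $\langle P_n,P_m\rangle_W=0$ for $n\ne m$). Differential operators $D=\sum_{j=0}^m\partial^jF_j(x)$ ($\partial=d/dx$) act on the right: $P\cdot D=\sum_j \partial^j(P)F_j$. $\mathcal D(W)$ is the algebra of such operators with matrix polynomial coefficients $F_j$ such that $P_n\cdot D=\Lambda_n(D)P_n$ for all $n\ge0$ with constant matrices $\Lambda_n(D)$. The right Fourier algebra $\mathcal F_R(W)$ is the set of differential operators $\mathfrak D$ with matrix polynomial coefficients for which there exist finitely many sequences of constant matrices $A_j(n)$, $-\ell\le j\le k$, with $P_n\cdot\mathfrak D=\sum_{j=-\ell}^kA_j(n)P_{n+j}$ for all $n$ (with $P_m=0$ for $m<0$). Darboux transformation: given weights $W_1,W_2$ with monic orthogonal polynomials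 $P_n,Q_n$, $W_2$ is a Darboux transformation of $W_1$ if there exist $\mathfrak D,\widetilde{\mathfrak D}\in\mathcal F_R(W_1)$, matrix polynomials $F,\widetilde F$ invertible as rational matrix functions, and sequences of constant matrices $C_n,\widetilde C_n$ nonsingular for almost every $n$ with $C_nQ_n=P_n\cdot\mathfrak D F^{-1}$ and $\widetilde C_nP_n=Q_n\cdot\widetilde F^{-1}\widetilde{\mathfrak D}$. Classical scalar weights: Hermite $w_b(x)=e^{-x^2+2bx}$ on $(-\infty,\infty)$ ($b\in\mathbb R$); Laguerre $w_\alpha(x)=e^{-x}x^\alpha$ on $(0,\infty)$ ($\alpha>-1$); Jacobi $w_{\alpha,\beta}(x)=(1-x)^\alpha(1+x)^\beta$ on $(-1,1)$ ($\alpha,\beta>-1$). Let $E_{s,t}$ be the matrix units, $A=\sum_{j=1}^{\lfloor N/2\rfloor}a_{2j-1}E_{2j-1,2j}+\sum_{j=1}^{\lfloor (N-1)/2\rfloor}a_{2j}E_{2j+1,2j}$ with all $a_j\in\mathbb R\setminus\{0\}$, and $T(x)=I+Ax$. Define $W_H=T\,\mathrm{diag}(w_{b_1},\dots,w_{b_N})\,T^*$ with $b_i$ pairwise distinct; $W_L=T\,\mathrm{diag}(w_{\alpha_1},\dots,w_{\alpha_N})\,T^*$ with $\alpha_i-\alpha_j\notin\mathbb Z$ for $i\neq j$; $W_J=T\,\mathrm{diag}(w_{\alpha_1,\beta_1},\dots,w_{\alpha_N,\beta_N})\,T^*$ with, for $i\ne j$, $\alpha_i-\alpha_j\notin\mathbb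 Z$ or $\beta_i-\beta_j\notin\mathbb Z$, and $\alpha_1+\beta_1=\alpha_j+\beta_j+1+(-1)^j$ for all $j=1,\dots,N$. *)

(* Defs.v *)
From HB Require Import structures.
From mathcomp Require Import all_boot all_order all_algebra.
From mathcomp Require Import generic_quotient.
From mathcomp Require Import all_classical all_reals all_analysis.
From mathcomp Require Import complex.

Set Implicit Arguments.
Unset Strict Implicit.
Unset Printing Implicit Defensive.

Import Order.TTheory GRing.Theory Num.Theory.
Local Open Scope classical_set_scope.
Local Open Scope ring_scope.

Section Defs.
Variable R : realType.
Local Notation C := (R[i]).
Variable N : nat.

Definition mpoly := 'M[{poly C}]_N.
Definition rfun := {fraction {poly C}}.

Definition RtoC (x : R) : C := Complex x 0.

Definition constM (M : 'M[C]_N) : mpoly := map_mx (fun c => c%:P) M.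

Definition evalM (P : mpoly) (x : R) : 'M[C]_N :=
  map_mx (fun p => p.[RtoC x]) P.

Definition adjM (M : 'M[C]_N) : 'M[C]_N := (map_mx (@conjc R) M)^T.

Definition monic_deg (n : nat) (P : mpoly) : Prop :=
  (forall i j, (size (P i j) <= n.+1)%N) /\
  \matrix_(i, j) (P i j)`_n = (1%:M : 'M[C]_N).

Definition cint_zero (I : set R) (f : R -> C) : Prop :=
  (lebesgue_measure).-integrable I (fun x => (complex.Re (f x))%:E) /\
  (lebesgue_measure).-integrable I (fun x => (complex.Im (f x))%:E) /\
  (\int[lebesgue_measure]_(x in I) (complex.Re (f x))%:E = 0)%E /\
  (\int[lebesgue_measure]_(x in I) (complex.Im (f x))%:E = 0)%E.

Definition orthW (I : set R) (W : R -> 'M[C]_N) (P Q : mpoly) : Prop :=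
  forall i j,
    cint_zero I (fun x => (evalM P x *m W x *m adjM (evalM Q x)) i j).

Definition is_MOP (I : set R) (W : R -> 'M[C]_N) (P : nat -> mpoly) : Prop :=
  forall n, monic_deg n (P n) /\
            forall m, m <> n -> orthW I W (P n) (P m).

(* A differential operator D = sum_j d^j F_j is represented by the
   sequence of its coefficients [F_0; F_1; ...]; acting on the right. *)
Definition diffop := seq mpoly.

Definition act (P : mpoly) (D : diffop) : mpoly :=
  \sum_(j < size D) map_mx (fun p => p^`(j)) P *m nth 0 D j.

Definition has_order (D : diffop) (k : nat) : Prop :=
  nth 0 D k != 0 /\ forall j, (k < j)%N -> nth 0 D j = 0.

Definition in_DW (I : set R) (W : R -> 'M[C]_N) (D : diffop) : Prop :=
  exists P, is_MOP I W P /\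
    forall n, exists L : 'M[C]_N, act (P n) D = constM L *m P n.

(* right Fourier algebra F_R(W) relative to the MOP sequence P;
   the i-th term of the sum corresponds to the shift j = i - l *)
Definition Pshift (P : nat -> mpoly) (n i l : nat) : mpoly :=
  if (l <= n + i)%N then P (n + i - l)%N else 0.

Definition in_FR (P : nat -> mpoly) (D : diffop) : Prop :=
  exists (l k : nat) (A : nat -> nat -> 'M[C]_N),
    forall n, act (P n) D =
      \sum_(i < l + k + 1) constM (A i n) *m Pshift P n i l.

Definition rderiv (r : rfun) : rfun :=
  let nx := (frac (repr r)).1 in let dx := (frac (repr r)).2 in
  FracField.tofrac (nx^`() * dx - nx * dx^`()) / FracField.tofrac (dx ^+ 2).

Definition toR (P : mpoly) : 'M[rfun]_N := map_mx (fun p => FracField.tofrac p) P.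

Definition actR (G : 'M[rfun]_N) (D : diffop) : 'M[rfun]_N :=
  \sum_(j < size D) map_mx (iter j rderiv) G *m toR (nth 0 D j).

Definition Darboux (I1 : set R) (W1 : R -> 'M[C]_N)
                   (I2 : set R) (W2 : R -> 'M[C]_N) : Prop :=
  exists (P Q : nat -> mpoly), is_MOP I1 W1 P /\ is_MOP I2 W2 Q /\
  exists (D D' : diffop) (F F' : mpoly) (Cn Cn' : nat -> 'M[C]_N),
    in_FR P D /\ in_FR P D' /\
    toR F \in unitmx /\ toR F' \in unitmx /\
    (exists n0, forall n, (n0 <= n)%N -> Cn n \in unitmx) /\
    (exists n0, forall n, (n0 <= n)%N -> Cn' n \in unitmx) /\
    (forall n, toR (constM (Cn n) *m Q n) =
               toR (act (P n) D) *m invmx (toR F)) /\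
    (forall n, toR (constM (Cn' n) *m P n) =
               actR (toR (Q n) *m invmx (toR F')) D').

Definition hermite (b : R) (x : R) : R := expR (- x ^+ 2 + 2 * b * x).
Definition laguerre (al : R) (x : R) : R := expR (- x) * x `^ al.
Definition jacobi (al be : R) (x : R) : R := (1 - x) `^ al * (1 + x) `^ be.

Definition I_H : set R := setT.
Definition I_L : set R := [set x | 0 < x].
Definition I_J : set R := [set x | -1 < x < 1].

Definition diagW (w : 'I_N -> R -> R) (x : R) : 'M[C]_N :=
  diag_mx (\row_i RtoC (w i x)).

Definition classical_sum (I1 : set R) (W1 : R -> 'M[C]_N) : Prop :=
  (I1 = I_H /\ exists b : 'I_N -> R,
      W1 = diagW (fun i => hermite (b i))) \/
  (I1 = I_L /\ exists al : 'I_N -> R, (forall i, -1 < al i) /\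
      W1 = diagW (fun i => laguerre (al i))) \/
  (I1 = I_J /\ exists al be : 'I_N -> R,
      (forall i, -1 < al i) /\ (forall i, -1 < be i) /\
      W1 = diagW (fun i => jacobi (al i) (be i))).

Definition Amat (a : nat -> R) : 'M[C]_N :=
  \matrix_(i, j)
    if ~~ odd i && (j == i.+1 :> nat) then RtoC (a i.+1)
    else if ~~ odd i && (2 <= i)%N && (j == i.-1 :> nat) then RtoC (a i)
    else 0.

Definition Tmat (a : nat -> R) (x : R) : 'M[C]_N :=
  1%:M + RtoC x *: Amat a.

Definition Wsym (a : nat -> R) (w : 'I_N -> R -> R) (x : R) : 'M[C]_N :=
  Tmat a x *m diagW w x *m adjM (Tmat a x).

Definition W_H (a : nat -> R) (b : 'I_N -> R) :=
  Wsym a (fun i => hermite (b i)).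
Definition W_L (a : nat -> R) (al : 'I_N -> R) :=
  Wsym a (fun i => laguerre (al i)).
Definition W_J (a : nat -> R) (al be : 'I_N -> R) :=
  Wsym a (fun i => jacobi (al i) (be i)).

Definition not_int (x : R) : Prop := ~ exists z : int, x = z%:~R.

Definition thm_concl (I : set R) (W : R -> 'M[C]_N) : Prop :=
  (exists D : diffop, has_order D 2 /\ in_DW I W D) /\
  (forall (I1 : set R) (W1 : R -> 'M[C]_N),
      classical_sum I1 W1 -> ~ Darboux I1 W1 I W).

End Defs.

(* Main.v *)
(** Write [L_j p] for the integral of [p w_j] over the interval, and [T = 1 + x A].
    Since [A D A = 0] for every diagonal [D], [T] has inverse [1 - x A] and
    [P |-> P T] turns the form of [W] into that of [diag(w_j)]. Let
    [sg f'' + tau_j f' + c_j f] be the classical operators; conjugating their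
    diagonal sum by [T] gives a symmetric operator which, for suitable constants
    [c_j], does not raise degrees, hence has the orthogonal polynomials of [W] as
    eigenfunctions.

    For the second part only [C_n Q_n = P_n . D F^-1] is used. With [d = det F],
    [d C_n Q_n T = P_n . E] where [E = D adj(F) T] has polynomial coefficients.
    The polynomials [P_n] are diagonal, so the entry [(i, j)] of the right-hand side
    is [p_n . E_ij] with [p_n] orthogonal for a scalar functional [om_i]. As
    [L_j (x^m (p_n . E_ij))] vanishes for large [n], there is a polynomial [phi] with
    [L_j (x^m (q . E_ij)) = om_i (phi q)] for all [q]; integrating by parts,
    [om_i (phi sg^r q) = L_j (rho q)]. If two entries in row [i] did not vanish
    identically, two of the functionals [L_j] would agree up to polynomial factors,
    i.e. [w_j / w_k] would be a rational function, which the hypotheses on the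
    parameters exclude. So every row of [C_n Q_n T] has at most one nonzero entry.
    If [A i0 j0 <> 0], multiplying such a row by [1 - x A] and comparing degrees shows
    that column [i0] of [C_n] vanishes, so that [C_n] is singular. *)
Require Import Defs.
From HB Require Import structures.
From mathcomp Require Import all_boot all_order all_algebra.
From mathcomp Require Import all_classical all_reals all_analysis.
From mathcomp Require Import measurable_realfun.
From mathcomp Require Import complex.
From mathcomp Require Import ring lra.

Set Implicit Arguments.
Unset Strict Implicit.
Unset Printing Implicit Defensive.

Import Order.TTheory GRing.Theory Num.Theory.
Import numFieldNormedType.Exports.
Local Open Scope ring_scope.

(** * Moment functionals satisfying a Pearson equation *)

Section Functional.
Variable R : realType.
Local Notation C := R[i].
Local Notation pconj := (map_poly (@conjc R)).

Definition posdef (L : {poly C} -> C) :=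
  forall p : {poly C}, p != 0 -> 0 < L (p * pconj p).

(** For integration against [w] with [(sg w)' = tau w], the argument times [w] is [(sg p w)']; the
    equation thus says that [sg p w] has no boundary contribution. *)
Definition pearson (sg tau : {poly C}) (L : {poly C} -> C) :=
  forall p : {poly C}, L (sg * p^`() + tau * p) = 0.

Lemma posdef_eq0 (L : {poly C} -> C) (p : {poly C}) :
  posdef L -> (forall q, L (p * q) = 0) -> p = 0.
Proof.
move=> posL Lp; apply/eqP; case: (eqVneq p 0) => // /posL.
by rewrite Lp ltxx.
Qed.

(** Each integration by parts removes one derivative from [q] and uses up one factor [sg], so
    [sg ^+ k] is what [k] of them require. The polynomial [rho] is the same for all [q]. *)
Lemma pearson_derivn (sg tau : {poly C}) (L : {scalar {poly C}}) k g :
  pearson sg tau L ->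
  exists rho, forall q, L (g * (sg ^+ k * q)^`(k)) = L (rho * q).
Proof.
move=> pL; elim: k g => [|k IH] g; first by exists g => q; rewrite mul1r.
have [rho Hrho] := IH g.
(* The last two terms come from the Pearson equation at [rho * q], which replaces [sg * rho * q'] by
   [- (tau * rho + sg * rho') * q]. *)
exists (rho * sg^`() *+ k.+1 - tau * rho - sg * rho^`()) => q.
have -> : (sg ^+ k.+1 * q)^`(k.+1) = (sg ^+ k * (sg^`() *+ k.+1 * q + sg * q^`()))^`(k).
  rewrite derivSn; congr (_ ^`(k)).
  rewrite derivM deriv_exp /= exprS; ring.
rewrite Hrho; have := pL (rho * q); rewrite derivM => H.
apply/eqP; rewrite -subr_eq0 -linearB /= -[X in _ == X]H; apply/eqP; congr (L _).
ring.
Qed.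

Definition dact (q : {poly C}) (e : seq {poly C}) : {poly C} :=
  \sum_(k < size e) q^`(k) * e`_k.

Lemma pearson_dact (sg tau : {poly C}) (L : {scalar {poly C}}) g e :
  pearson sg tau L ->
  exists rho, forall q, L (g * dact (sg ^+ size e * q) e) = L (rho * q).
Proof.
move=> pL.
have /choice [f Hf] : forall k : 'I_(size e), exists rho : {poly C},
    forall q, L (g * ((sg ^+ size e * q)^`(k) * e`_k)) = L (rho * q).
  move=> k; have [rho Hrho] := pearson_derivn k (g * e`_k) pL.
  (* One power [sg ^+ size e] serves all orders; the surplus over [sg ^+ k] is absorbed into
     [rho]. *)
  exists (rho * sg ^+ (size e - k)) => q.
  rewrite -mulrA -Hrho [sg ^+ k * _]mulrA -exprD subnKC 1?ltnW //.
  by congr (L _); ring.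
exists (\sum_k f k) => q.
rewrite /dact mulr_sumr mulr_suml !raddf_sum.
by apply: eq_bigr => k _; exact: Hf.
Qed.

Definition monic_seq (p : nat -> {poly C}) :=
  forall n, (size (p n) <= n.+1)%N /\ (p n)`_n = 1.

Lemma monic_seq_eq (p : nat -> {poly C}) (L L' : {scalar {poly C}}) :
  monic_seq p -> (forall n, L (p n) = L' (p n)) -> forall q, L q = L' q.
Proof.
move=> mp H q; have [n] := ubnP (size q); elim: n q => [|n IH] q; first by rewrite ltn0.
rewrite ltnS => sq; case: n => [|n] in IH sq *.
  by move: sq; rewrite size_poly_leq0 => /eqP->; rewrite !raddf0.
have [sp pn1] := mp n.
suff /IH E : (size (q - q`_n *: p n)%R < n.+1)%N.
  by rewrite -(subrK (q`_n *: p n) q) linearD [RHS]linearD /= E !linearZ /= H.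
rewrite ltnS; apply/leq_sizeP => j.
rewrite leq_eqVlt => /predU1P[<-|lt_nj]; rewrite coefB coefZ.
  by rewrite pn1 mulr1 subrr.
rewrite (nth_default 0 (leq_trans sq lt_nj)) (nth_default 0 (leq_trans sp lt_nj)).
by rewrite mulr0 subr0.
Qed.

(** Riesz representation in the orthogonal basis [p n]: as [Phi] kills all but finitely many of
    them, the sum of [Phi (p n) / nrm n] times the conjugate of [p n] is finite, hence a
    polynomial. *)
Lemma functional_repr (om Phi : {scalar {poly C}}) (p : nat -> {poly C}) K :
  posdef om -> monic_seq p ->
  (forall n m, n != m -> om (p n * pconj (p m)) = 0) ->
  (forall n, (K <= n)%N -> Phi (p n) = 0) ->
  exists phi, forall q, Phi q = om (phi * q).
Proof.
move=> pom mp orth Phi0.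
pose nrm n := om (p n * pconj (p n)).
have nrm0 n : nrm n != 0.
  apply: lt0r_neq0; apply: pom; apply: contraTneq isT => p0.
  by have [_] := mp n; rewrite p0 coef0 => /esym/eqP; rewrite oner_eq0.
pose phi := \sum_(n < K) (Phi (p n) / nrm n) *: pconj (p n).
exists phi => q.
have lin : scalar (fun q => om (phi * q)).
  by move=> c x y; rewrite mulrDr -scalerAr linearP.
pose omphi : {scalar {poly C}} :=
  HB.pack (fun q => om (phi * q)) (GRing.isLinear.Build _ _ _ _ _ lin).
apply: (@monic_seq_eq p Phi omphi mp) => m /=.
rewrite /omphi/= /phi mulr_suml raddf_sum /=.
have [ltmK|leKm] := ltnP m K.
  rewrite (bigD1 (Ordinal ltmK)) //= big1 => [|i ne_im].
    by rewrite addr0 -scalerAl linearZ /= mulrC [_ * p m]mulrC mulrC divfK.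
  by rewrite -scalerAl linearZ /= mulrC [_ * p m]mulrC orth ?mul0r // eq_sym.
rewrite Phi0 // big1 // => i _.
rewrite -scalerAl linearZ /= mulrC [_ * p m]mulrC orth ?mul0r //.
by rewrite gtn_eqF // (leq_trans _ leKm).
Qed.

(* Both sides of [L1 (P1 * q) = L2 (P2 * q)] satisfy a Pearson equation; since
   the functional is nonzero these must be proportional, which is the identity
   [(w2 / w1)' / (w2 / w1) = (P1 / P2)' / (P1 / P2)] multiplied by [sg * P1 * P2]. *)
Lemma pearson_ratio (sg t1 t2 P1 P2 : {poly C}) (L1 L2 : {scalar {poly C}}) :
  pearson sg t1 L1 -> pearson sg t2 L2 -> posdef L1 -> P1 != 0 ->
  (forall q, L1 (P1 * q) = L2 (P2 * q)) ->
  sg * (P1^`() * P2 - P1 * P2^`()) + (t1 - t2) * P1 * P2 = 0.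
Proof.
move=> p1 p2 pos P10 H.
set Z := (X in X = 0).
suff /eqP: P1 * Z = 0 by rewrite mulf_eq0 (negPf P10) => /eqP.
apply: (posdef_eq0 pos) => k.
(* The test polynomials are chosen so that, once [L2 (P2 * _)] is rewritten as [L1 (P1 * _)], the
   terms with [k'] cancel and [L1 (P1 * Z * k) = 0] remains for every [k]. *)
have e1 := p1 (P1 * (P1 * (P2 * k))).
have e2 := p2 (P2 * (P2 * (P1 * k))).
rewrite !derivM in e1 e2.
have {}e1 : L1 (P1 * (sg * (P1 * (P2^`() * k + P2 * k^`())) + sg * (P1^`() * (P2 * k)) *+ 2
   + t1 * (P1 * (P2 * k)))) = 0.
  rewrite -[RHS]e1; congr (L1 _); ring.
have {}e2 : L2 (P2 * (sg * (P2 * (P1^`() * k + P1 * k^`())) + sg * (P2^`() * (P1 * k)) *+ 2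
   + t2 * (P2 * (P1 * k)))) = 0.
  rewrite -[RHS]e2; congr (L2 _); ring.
rewrite -H in e2; apply: (etrans _ (subrr 0)).
rewrite -{1}e1 -e2 -linearB /=; congr (L1 _); rewrite /Z; ring.
Qed.

(** The first two terms have degree below that of [P1 * P2], so they cannot cancel [c P1 P2]. This
    is the irrationality of [exp (c x)]. *)
Lemma no_ratio_deg (c : C) (P1 P2 : {poly C}) : c != 0 -> P1 != 0 -> P2 != 0 ->
  P1^`() * P2 - P1 * P2^`() + c%:P * P1 * P2 != 0.
Proof.
move=> c0 P10 P20; rewrite addrC addr_eq0 -mulrA mul_polyC; apply/negP => /eqP.
move/(congr1 (fun p => size (p : {poly C}))); rewrite size_scale // size_polyN => /eqP.
rewrite gtn_eqF // (leq_ltn_trans (size_polyD _ _)) // size_polyN gtn_max.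
have lt (p q : {poly C}) : p != 0 -> q != 0 -> (size (p^`() * q)%R < size (p * q)%R)%N.
  move=> p0 q0; rewrite [X in (_ < X)%N]size_mul // (leq_ltn_trans (size_polyMleq _ _)) //.
  have := lt_size_deriv p0; have := q0; rewrite -size_poly_gt0.
  by case: (size q) => // k _ H; rewrite !addnS /= ltn_add2r.
by rewrite lt //= mulrC [P1 * P2]mulrC lt.
Qed.

(** Local exponents at [c]: a rational [P1 / P2] has integer order there, while the equation would
    make [t / s] at [c] the difference of the two multiplicities. *)
Lemma no_ratio_root (c : C) (s t P1 P2 : {poly C}) :
  s.[c] != 0 -> P1 != 0 -> P2 != 0 ->
  (forall k : int, t.[c] != s.[c] * k%:~R) ->
  ('X - c%:P) * s * (P1^`() * P2 - P1 * P2^`()) + t * P1 * P2 != 0.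
Proof.
move=> sc P10 P20 tc; apply/negP => /eqP E.
have [m1 [Q1 q1c E1]] := multiplicity_XsubC P1 c.
have [m2 [Q2 q2c E2]] := multiplicity_XsubC P2 c.
rewrite P10 /= in q1c; rewrite P20 /= in q2c.
set X := 'X - c%:P in E1 E2 E.
have dX : X^`() = 1 by rewrite derivB derivX derivC subr0.
(* The extra factor [X] avoids the exponent [m - 1], so [m = 0] fits the same formula. *)
have dXn m : X * (X ^+ m)^`() = (X ^+ m) *+ m.
  rewrite deriv_exp dX mul1r; case: m => [|m]; first by rewrite !mulr0n mulr0.
  by rewrite /= mulrnAr -exprS.
have XK m : X ^+ m != 0 by rewrite expf_neq0 // polyXsubC_eq0.
have : X ^+ m1 * X ^+ m2 * (s * (Q1 * Q2 *+ m1 - Q1 * Q2 *+ m2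
    + X * (Q1^`() * Q2 - Q1 * Q2^`())) + t * Q1 * Q2) = 0.
  rewrite -[RHS]E E1 E2 !derivM.
  move: (X ^+ m1) (X ^+ m2) (dXn m1) (dXn m2) => u v du dv.
  apply/eqP; rewrite -subr_eq0; apply/eqP.
  transitivity (s * Q1 * Q2 * (v * (u *+ m1 - X * u^`()) - u * (v *+ m2 - X * v^`()))).
    ring.
  by rewrite du dv !subrr !mulr0 subrr mulr0.
(* With [X ^+ (m1 + m2)] divided out, evaluation at [c] leaves [s (m1 - m2) + t] times the nonzero
   value of [Q1 * Q2]. *)
move/eqP; rewrite !mulf_eq0 !(negPf (XK _)) /= => /eqP /(congr1 (horner^~ c)).
rewrite /X !hornerE subrr mul0r addr0 !hornerMn.
move=> H; have := tc (m2%:Z - m1%:Z); rewrite -subr_eq0.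
have Q0 : (Q1 * Q2).[c] != 0 by rewrite hornerM mulf_neq0.
rewrite -(mulIr_eq0 _ (mulIf Q0)) hornerM; apply/negP; rewrite negbK.
apply/eqP; rewrite -[RHS]H hornerM intrB !pmulrn; ring.
Qed.
End Functional.

(** * Matrix polynomials and the Darboux relation *)

Section MatrixPolynomials.
Variables (R : realType) (N : nat).
Local Notation C := R[i].
Local Notation pconj := (map_poly (@conjc R)).
Local Notation mpoly := (mpoly R N).
Local Notation constM := (@constM R N).

Lemma constM_mulE (K : 'M[C]_N) (P : mpoly) i j :
  (constM K *m P) i j = \sum_k K i k *: P k j.
Proof. by rewrite mxE; apply: eq_bigr => k _; rewrite mxE mul_polyC. Qed.

Lemma coef_constM_mul (K : 'M[C]_N) (P : mpoly) n : monic_deg n P ->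
  \matrix_(i, j) ((constM K *m P) i j)`_n = K.
Proof.
case=> _ mP; rewrite -[RHS]mulmx1 -mP; apply/matrixP => i j.
by rewrite mxE constM_mulE coef_sum !mxE; apply: eq_bigr => k _; rewrite coefZ mxE.
Qed.

Lemma size_constM_mul (K : 'M[C]_N) (P : mpoly) n :
  (forall i j, size (P i j) <= n)%N ->
  forall i j, (size ((constM K *m P) i j) <= n)%N.
Proof.
move=> sP i j; rewrite constM_mulE; apply: (leq_trans (size_sum _ _ _)).
apply/bigmax_leqP => k _; exact: leq_trans (size_scale_leq _ _) (sP _ _).
Qed.

Lemma actE (P : mpoly) (D : diffop R N) i j :
  act P D i j = \sum_l dact (P i l) [seq (F : mpoly) l j | F <- D].
Proof.
rewrite /act summxE /dact.
under eq_bigr do rewrite mxE.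
rewrite exchange_big /=; apply: eq_bigr => l _; rewrite size_map.
apply: eq_bigr => k _; rewrite mxE (nth_map 0) //.
Qed.

Lemma act_mulr (P : mpoly) (D : diffop R N) (M : mpoly) :
  act P D *m M = act P [seq F *m M | F <- D].
Proof.
rewrite /act mulmx_suml size_map; apply: eq_bigr => k _.
by rewrite (nth_map 0) // mulmxA.
Qed.

(** * A differential operator applied to a diagonal orthogonal sequence *)

Section NoDarboux.
Variables (om L : 'I_N -> {scalar {poly C}}) (sg : {poly C}) (tau : 'I_N -> {poly C}).
Variables (P M : nat -> mpoly) (E : diffop R N).
Hypothesis om_pos : forall i, posdef (om i).
Hypothesis L_pos : forall i, posdef (L i).
Hypothesis L_pearson : forall i, pearson sg (tau i) (L i).
Hypothesis sg0 : sg != 0.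
Hypothesis no_ratio : forall j k, j != k -> forall P1 P2 : {poly C},
  P1 != 0 -> P2 != 0 ->
  sg * (P1^`() * P2 - P1 * P2^`()) + (tau j - tau k) * P1 * P2 != 0.
Hypothesis P_diag : forall n i j, i != j -> P n i j = 0.
Hypothesis P_monic : forall i, monic_seq (fun n => P n i i).
Hypothesis P_orth : forall i n m, n != m -> om i (P n i i * pconj (P m i i)) = 0.
Hypothesis ME : forall n, M n = act (P n) E.
Hypothesis M_orth : forall i j m, exists K, forall n, (K <= n)%N ->
  L j ('X^m * M n i j) = 0.

Let e i j := [seq (F : mpoly) i j | F <- E].

Lemma act_diagE n i j : M n i j = dact (P n i i) (e i j).
Proof.
rewrite ME actE (bigD1 i) //= big1 ?addr0 // => l li.
rewrite P_diag 1?eq_sym // /dact big1 // => k _.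
by rewrite linear0 mul0r.
Qed.

(** A nonzero entry ties [om i] to [L j] up to polynomial factors: [phi] represents
    [q |-> L j ('X^m * dact q (e i j))] through [om i], and [rho] results from integrating by
    parts. *)
Lemma darboux_entry_functional i j n : M n i j != 0 ->
  exists phi rho : {poly C}, [/\ phi != 0, rho != 0 &
    forall q, om i (phi * (sg ^+ size E * q)) = L j (rho * q)].
Proof.
move=> Mn0.
(* By positivity of [L j] a nonzero polynomial is not annihilated by all monomials. *)
have [m Lm] : exists m, L j ('X^m * M n i j) != 0.
  apply: contrapT => /forallNP H; move/eqP: Mn0; apply.
  apply: (posdef_eq0 (@L_pos j)) => q.
  rewrite mulrC -[q]coefK poly_def mulr_suml linear_sum big1 // => m _ /=.
  by rewrite -scalerAl linearZ /=; move/negP: (H m); rewrite negbK => /eqP ->; rewrite mulr0.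
have lin : scalar (fun q => L j ('X^m * dact q (e i j))).
  move=> c x y; rewrite /dact -linearP scalerAr -mulrDr /=; congr (L j (_ * _)).
  rewrite scaler_sumr -big_split; apply: eq_bigr => k _ /=.
  by rewrite linearP mulrDl scalerAl.
pose Phi : {scalar {poly C}} :=
  HB.pack (fun q => L j ('X^m * dact q (e i j))) (GRing.isLinear.Build _ _ _ _ _ lin).
have [K HK] := M_orth i j m.
have [phi Hphi] : exists phi, forall q, Phi q = om i (phi * q).
  apply: (functional_repr (K := K) (@om_pos i) (P_monic i) (P_orth i)).
  by move=> k Kk; rewrite /Phi /= -act_diagE HK.
have [rho Hrho] := pearson_dact 'X^m (e i j) (@L_pearson j).
have phi0 : phi != 0.
  apply: contraNneq Lm => phi0; have := Hphi (P n i i).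
  by rewrite phi0 mul0r raddf0 /Phi /= -act_diagE => ->.
have H q : om i (phi * (sg ^+ size E * q)) = L j (rho * q).
  by rewrite -Hphi /= -Hrho size_map.
exists phi, rho; split=> //.
(* If [rho] were zero, [om i] would vanish on all multiples of [phi * sg ^+ size E], which is
   nonzero. *)
apply: contraTneq isT => rho0.
have : phi * sg ^+ size E = 0.
  by apply: (posdef_eq0 (@om_pos i)) => q; rewrite -mulrA H rho0 mul0r raddf0.
by move/eqP; rewrite mulf_eq0 (negPf phi0) expf_eq0 (negPf sg0) andbF.
Qed.

(** Two nonzero entries of row [i] are tied to the same [om i]. Cross-multiplying by the two [phi]
    gives [L j (r1 f2 q) = L k (r2 f1 q)], and [pearson_ratio] then contradicts [no_ratio]. *)
Lemma darboux_entry_unique i j k : j != k ->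
  (forall n, M n i j = 0) \/ (forall n, M n i k = 0).
Proof.
move=> jk; apply: contrapT => /not_orP [/existsNP [n /eqP nj] /existsNP [m /eqP mk]].
have [f1 [r1 [f10 r10 H1]]] := darboux_entry_functional nj.
have [f2 [r2 [f20 r20 H2]]] := darboux_entry_functional mk.
have := no_ratio jk (mulf_neq0 r10 f20) (mulf_neq0 r20 f10).
apply/negP; rewrite negbK; apply/eqP.
apply: (pearson_ratio (L_pearson j) (L_pearson k) (@L_pos j)) => [|q].
  exact: mulf_neq0.
rewrite -!mulrA -H1 -H2; congr (om i _).
by rewrite mulrCA [RHS]mulrCA; congr (_ * _); rewrite mulrCA.
Qed.
End NoDarboux.
End MatrixPolynomials.

(** * Matrix orthogonal polynomials *)

Section InnerProduct.
Variables (R : realType) (N : nat).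
Local Notation C := R[i].
Local Notation pconj := (map_poly (@conjc R)).
Local Notation mpoly := (mpoly R N).
Local Notation constM := (@constM R N).

Definition hermitian (L : {poly C} -> C) := forall p, L (pconj p) = conjc (L p).

Variables (L : 'I_N -> {scalar {poly C}}) (T : mpoly).
Hypothesis L_pos : forall i, posdef (L i).
Hypothesis L_herm : forall i, hermitian (L i).

(** The form of [T diag(w) T^*], written as [(P T) diag(w) (Q T)^*]. On the real line the adjoint
    conjugates coefficients only, hence [pconj] and no integral. *)
Definition wip (P Q : mpoly) : 'M[C]_N :=
  \matrix_(r, s) \sum_j L j ((P *m T) r j * pconj ((Q *m T) s j)).

Lemma pconjK (p : {poly C}) : pconj (pconj p) = p.
Proof. by apply/polyP => k; rewrite !coef_map; exact: conjcK. Qed.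

Lemma wipDl P P' Q : wip (P + P') Q = wip P Q + wip P' Q.
Proof.
apply/matrixP => r s; rewrite !mxE -big_split; apply: eq_bigr => j _ /=.
by rewrite mulmxDl mxE mulrDl linearD.
Qed.

Lemma wip_constMl K P Q : wip (constM K *m P) Q = K *m wip P Q.
Proof.
apply/matrixP => r s; rewrite !mxE.
under [RHS]eq_bigr do rewrite mxE mulr_sumr.
rewrite exchange_big /=; apply: eq_bigr => j _.
rewrite -mulmxA constM_mulE mulr_suml linear_sum; apply: eq_bigr => k _.
by rewrite -scalerAl linearZ.
Qed.

Lemma wip0l Q : wip 0 Q = 0.
Proof. by have := wip_constMl 0 0 Q; rewrite mul0mx mulmx0. Qed.

Lemma wipC P Q : wip Q P = adjM (wip P Q).
Proof.
apply/matrixP => r s; rewrite !mxE rmorph_sum; apply: eq_bigr => j _ /=.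
by rewrite -L_herm rmorphM /= pconjK mulrC.
Qed.

Lemma adjM0 : adjM (0 : 'M[C]_N) = 0.
Proof. by rewrite /adjM map_mx0 trmx0. Qed.

Lemma adjMM (K K' : 'M[C]_N) : adjM (K *m K') = adjM K' *m adjM K.
Proof. by rewrite /adjM map_mxM trmx_mul. Qed.

Lemma wipC0 P Q : wip P Q = 0 -> wip Q P = 0.
Proof. by move=> PQ; rewrite wipC PQ adjM0. Qed.

Lemma wip_constMr K P Q : wip P (constM K *m Q) = wip P Q *m adjM K.
Proof. by rewrite wipC wip_constMl adjMM -wipC. Qed.

Lemma wip_suml I (r : seq I) (F : I -> mpoly) Q :
  wip (\sum_(i <- r) F i) Q = \sum_(i <- r) wip (F i) Q.
Proof. by elim/big_rec2: _ => [|i x y _ <-]; rewrite ?wip0l ?wipDl. Qed.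

Lemma wip_def P : wip P P = 0 -> P *m T = 0.
Proof.
move=> PP; apply/matrixP => r j; rewrite [RHS]mxE.
have := congr1 (fun M : 'M[C]_N => M r r) PP; rewrite /wip 2!mxE => /eqP.
have ge0 k : 0 <= L k ((P *m T) r k * pconj ((P *m T) r k)).
  by case: (eqVneq ((P *m T) r k) 0) => [->|/L_pos/ltW//]; rewrite mul0r linear0.
rewrite psumr_eq0; last by move=> k _; exact: ge0.
move=> /allP /(_ j (mem_index_enum _)) /= /eqP L0; apply/eqP.
by apply: contraT => /(L_pos j); rewrite L0 ltxx.
Qed.

(** Orthogonality is to everything of degree below [n] ([size] is degree plus one), so the notion
    concerns a single polynomial and not a whole sequence. *)
Definition mop (n : nat) (P : mpoly) := monic_deg n P /\
  forall Q : mpoly, (forall i j, size (Q i j) <= n)%N -> wip P Q = 0.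

Lemma monic_expand (f : nat -> mpoly) n (Q : mpoly) :
  (forall k, (k < n)%N -> monic_deg k (f k)) ->
  (forall i j, size (Q i j) <= n)%N ->
  exists K : nat -> 'M[C]_N, Q = \sum_(k < n) constM (K k) *m f k.
Proof.
elim: n Q => [|n IH] Q mf sQ.
  exists (fun=> 0); rewrite big_ord0; apply/matrixP => i j; rewrite mxE.
  by apply/eqP; rewrite -size_poly_leq0.
pose B : 'M[C]_N := \matrix_(i, j) (Q i j)`_n.
have [||K HK] := IH (Q - constM B *m f n).
- by move=> k kn; apply: mf; apply: ltnW.
- move=> i j; apply/leq_sizeP => k; rewrite leq_eqVlt.
  rewrite mxE [X in _ + X]mxE coefB => /predU1P[<-|nk].
    have := congr1 (fun M : 'M[C]_N => M i j) (coef_constM_mul B (mf n (ltnSn n))).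
    by rewrite !mxE => ->; rewrite subrr.
  rewrite nth_default ?(leq_trans (sQ i j)) //.
  by rewrite nth_default ?subr0 // (leq_trans (size_constM_mul _ (proj1 (mf n _)) _ _)).
exists (fun k => if k == n then B else K k).
rewrite big_ord_recr /= eqxx -[LHS](subrK (constM B *m f n)) HK; congr (_ + _).
by apply: eq_bigr => k _; rewrite ltn_eqF.
Qed.

Lemma mop_of_seq (f : nat -> mpoly) : (forall n, monic_deg n (f n)) ->
  (forall n m, m <> n -> wip (f n) (f m) = 0) -> forall n, mop n (f n).
Proof.
move=> mf of_ n; split => // Q sQ.
have [K ->] := monic_expand (fun k _ => mf k) sQ.
apply: wipC0; rewrite wip_suml big1 // => k _.
by rewrite wip_constMl of_ ?mulmx0 // => /eqP; rewrite gtn_eqF.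
Qed.

Lemma wip_mop_neq (P Q : mpoly) n m : mop n P -> mop m Q -> n != m -> wip P Q = 0.
Proof.
move=> [[sP _] oP] [[sQ _] oQ]; rewrite neq_ltn => /orP[nm|mn].
  by apply/wipC0/oQ => i j; exact: leq_trans (sP i j) nm.
by apply: oP => i j; exact: leq_trans (sQ i j) mn.
Qed.

Variable T' : mpoly.
Hypothesis TT' : T *m T' = 1%:M.

Lemma wip_eq0 P : wip P P = 0 -> P = 0.
Proof. by move/wip_def => PT; rewrite -[P]mulmx1 -TT' mulmxA PT mul0mx. Qed.

(** A matrix [K] in the left kernel makes [K P] isotropic, hence zero; but [K] is the leading
    coefficient of [K P]. *)
Lemma gram_unit P n : monic_deg n P -> wip P P \in unitmx.
Proof.
move=> mP; rewrite -row_free_unit -kermx_eq0; set K := kermx _.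
have /wip_eq0 KP : wip (constM K *m P) (constM K *m P) = 0.
  by rewrite wip_constMl wip_constMr mulmxA mulmx_ker mul0mx.
rewrite -(coef_constM_mul K mP) KP; apply/eqP/matrixP => i j.
by rewrite !mxE coef0.
Qed.

(** Gram-Schmidt applied to [X^n] times the identity; the Gram matrices can be inverted by
    [gram_unit]. *)
Lemma mop_exists n : exists P, mop n P.
Proof.
have [m] := ubnP n; elim: m n => [|m IH] n; first by rewrite ltn0.
rewrite ltnS => nm.
(* Only indices below [n] carry information; the value 0 at the others is a filler. *)
have /choice [f Hf] : forall k, exists P, (k < n)%N -> mop k P.
  move=> k; have [kn|_] := ltnP k n; last by exists 0.
  by have [P HP] := IH k (leq_trans kn nm); exists P.
pose Xn : mpoly := ('X^n)%:M.
pose G k := wip Xn (f k) *m invmx (wip (f k) (f k)).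
pose S : mpoly := \sum_(k < n) constM (- G k) *m f k.
have sS i j : (size (S i j) <= n)%N.
  rewrite /S summxE; apply: (leq_trans (size_sum _ _ _)); apply/bigmax_leqP => k _.
  have [[sk _] _] := Hf k (ltn_ord k).
  exact: leq_trans (size_constM_mul _ sk _ _) (ltn_ord k).
exists (Xn + S); split; first split.
- move=> i j; rewrite mxE (leq_trans (size_polyD _ _)) // geq_max (leqW (sS i j)) andbT.
  by rewrite mxE; case: (i == j); rewrite ?mulr0n ?size_poly0 // mulr1n size_polyXn.
- apply/matrixP => i j; rewrite !mxE coefD (nth_default 0 (sS i j)) addr0.
  by case: (i == j); rewrite ?mulr0n ?coef0 // !mulr1n coefXn eqxx.
move=> Q sQ; have [K ->] := monic_expand (fun k kn => proj1 (Hf k kn)) sQ.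
apply: wipC0; rewrite wip_suml big1 // => k _; rewrite wip_constMl.
suff -> : wip (f k) (Xn + S) = 0 by rewrite mulmx0.
apply: wipC0; rewrite wipDl /S wip_suml (bigD1 k) //= big1.
  rewrite addr0 wip_constMl mulNmx /G mulmxKV ?subrr //.
  exact: gram_unit (proj1 (Hf k _)).
move=> l lk; rewrite wip_constMl (wip_mop_neq (Hf l _) (Hf k _)) ?mulmx0 //.
Qed.

(** With [Lam] the coefficient of degree [n], [X = P . D - Lam P] has degree below [n]. By symmetry
    its product with itself equals that of [P] with [X . D] minus [Lam] times that of [P] with [X];
    both vanish, so [X = 0]. *)
Lemma mop_eigen (D : diffop R N) n P :
  (forall Q : mpoly, (forall i j, size (Q i j) <= n)%N ->
     forall i j, (size (act Q D i j) <= n)%N) ->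
  (forall i j, (size (act P D i j) <= n.+1)%N) ->
  (forall Q Q', wip (act Q D) Q' = wip Q (act Q' D)) ->
  mop n P -> exists Lam : 'M[C]_N, act P D = constM Lam *m P.
Proof.
move=> sD sP symD [mP oP].
pose Lam : 'M[C]_N := \matrix_(i, j) (act P D i j)`_n.
exists Lam; apply/eqP; rewrite -subr_eq0 -mulNmx; apply/eqP.
have -> : - constM Lam = constM (- Lam).
  by apply/matrixP => i j; rewrite !mxE polyCN.
set X := _ + _.
have sX i j : (size (X i j) <= n)%N.
  apply/leq_sizeP => k; rewrite leq_eqVlt mxE coefD => /predU1P[<-|nk].
    have := congr1 (fun M : 'M[C]_N => M i j) (coef_constM_mul (- Lam) mP).
    by rewrite mxE => ->; rewrite !mxE subrr.
  rewrite nth_default ?(leq_trans (sP i j)) // nth_default ?addr0 //.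
  exact: leq_trans (size_constM_mul _ (proj1 mP) _ _) nk.
apply: wip_eq0; rewrite {1}/X wipDl symD wip_constMl (oP X) // mulmx0 addr0.
by apply: oP => i j; exact: sD.
Qed.
End InnerProduct.

(** * Conjugation by [T = 1 + x A] *)

Section Nilpotent.
Variables (R : realType) (N : nat).
Local Notation C := R[i].
Local Notation pconj := (map_poly (@conjc R)).
Local Notation mpoly := (mpoly R N).
Local Notation constM := (@constM R N).

Variable A : 'M[C]_N.
Hypothesis A_nil : forall i k j, A i k * A k j = 0.

Definition Tpoly : mpoly := 1%:M + 'X *: constM A.
Definition Tinv : mpoly := 1%:M - 'X *: constM A.

(** The entrywise hypothesis is stronger than [A^2 = 0]: it survives the insertion of any diagonal
    matrix, even a polynomial one. *)
Lemma nil_diag (d : 'rV[{poly C}]_N) : constM A *m diag_mx d *m constM A = 0.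
Proof.
apply/matrixP => i j; rewrite mul_mx_diag !mxE big1 // => k _.
by rewrite !mxE mulrAC -polyCM A_nil mul0r.
Qed.

Lemma nil_sqr : constM A *m constM A = 0.
Proof.
have := nil_diag (const_mx 1); rewrite diag_const_mx mulmx1 => <-; by [].
Qed.

Lemma TpolyK : Tpoly *m Tinv = 1%:M.
Proof.
rewrite /Tpoly /Tinv mulmxDl mul1mx mulmxBr mulmx1 -scalemxAl -scalemxAr.
by rewrite nil_sqr !scaler0 subr0 subrK.
Qed.

Lemma TinvK : Tinv *m Tpoly = 1%:M.
Proof. exact: mulmx1C TpolyK. Qed.

Lemma nilT : constM A *m Tpoly = constM A.
Proof. by rewrite mulmxDr mulmx1 -scalemxAr nil_sqr scaler0 addr0. Qed.

Lemma nil_diagT d : constM A *m diag_mx d *m Tpoly = constM A *m diag_mx d.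
Proof. by rewrite mulmxDr mulmx1 -scalemxAr nil_diag scaler0 addr0. Qed.

(** The quadratic term [x^2 A d A] vanishes, so conjugation only adds the commutator
    [x (A d - d A)]. *)
Lemma conj_diagE d i j : (Tpoly *m diag_mx d *m Tinv) i j =
  d 0 i *+ (i == j) + A i j *: ('X * (d 0 j - d 0 i)).
Proof.
have -> : Tpoly *m diag_mx d *m Tinv = diag_mx d +
    'X *: (constM A *m diag_mx d) - 'X *: (diag_mx d *m constM A).
  rewrite /Tpoly /Tinv mulmxBr mulmx1 !mulmxDl mul1mx -!scalemxAl -!scalemxAr.
  by rewrite nil_diag !scaler0 addr0.
rewrite mul_mx_diag mul_diag_mx !mxE -mul_polyC.
by ring.
Qed.

Lemma mulTE (M : mpoly) i j :
  (M *m Tpoly) i j = M i j + 'X * (M *m constM A) i j.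
Proof. by rewrite mulmxDr mulmx1 -scalemxAr mxE [X in _ + X]mxE. Qed.

Lemma deriv_mul_constM (M : mpoly) i j :
  ((M *m constM A) i j)^`() = (map_mx (@deriv _) M *m constM A) i j.
Proof.
rewrite !mxE linear_sum; apply: eq_bigr => k _ /=.
by rewrite !mxE derivM derivC mulr0 addr0.
Qed.

Lemma deriv_mulT (M : mpoly) i j : ((M *m Tpoly) i j)^`() =
  (map_mx (@deriv _) M *m Tpoly) i j + (M *m constM A) i j.
Proof.
rewrite !mulTE derivD derivM derivX mul1r deriv_mul_constM [map_mx _ _ i j]mxE.
by rewrite [_ i j + 'X * _]addrC addrA addrC addrA addrAC.
Qed.

(** * The second-order operator, its degrees and its symmetry *)

Section Operator.
Variables (sg : {poly C}) (tau : 'I_N -> {poly C}) (c : 'I_N -> C).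

Definition scalar_op i (f : {poly C}) := sg * f^`(2) + tau i * f^`() + c i *: f.

Let dt : 'rV[{poly C}]_N := \row_j tau j.
Let dc : 'rV[{poly C}]_N := \row_j (c j)%:P.

(** The expansion of [P |-> (P T . diag(scalar_op)) T^-1], using [(P T)' = P' T + P A],
    [(P T)'' = P'' T + 2 P' A] and [A d T^-1 = A d] for diagonal [d]. *)
Definition bochner_op : diffop R N :=
  [:: constM A *m diag_mx dt + Tpoly *m diag_mx dc *m Tinv;
      (sg *+ 2) *: constM A + Tpoly *m diag_mx dt *m Tinv;
      sg%:M].

Lemma bochner_op_T P i j :
  (act P bochner_op *m Tpoly) i j = scalar_op j ((P *m Tpoly) i j).
Proof.
pose P1 := map_mx (fun p : {poly C} => p^`()) P.
pose P2 := map_mx (fun p : {poly C} => p^`(2)) P.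
have eT d : Tpoly *m diag_mx d *m Tinv *m Tpoly = Tpoly *m diag_mx d.
  by rewrite -mulmxA TinvK mulmx1.
have -> : act P bochner_op *m Tpoly =
    P *m constM A *m diag_mx dt + P *m Tpoly *m diag_mx dc
    + (sg *+ 2) *: (P1 *m constM A) + P1 *m Tpoly *m diag_mx dt + sg *: (P2 *m Tpoly).
  rewrite /act !big_ord_recl big_ord0 addr0 /=.
  have -> : map_mx (fun p : {poly C} => p^`(0)) P = P.
    by apply/matrixP => k l; rewrite mxE.
  set F0 := constM A *m _ + _; set F1 := _ *: _ + _.
  have E0 : F0 *m Tpoly = constM A *m diag_mx dt + Tpoly *m diag_mx dc.
    by rewrite mulmxDl nil_diagT eT.
  have E1 : F1 *m Tpoly = (sg *+ 2) *: constM A + Tpoly *m diag_mx dt.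
    by rewrite mulmxDl -scalemxAl nilT eT.
  rewrite !mulmxDl -!(mulmxA _ _ Tpoly) E0 E1 mul_scalar_mx.
  rewrite (mulmxDr P) (mulmxDr (map_mx _ P) (_ *: _)) -!scalemxAr !mulmxA !addrA.
  by [].
have e1 := deriv_mulT P i j.
have e2 : ((P *m Tpoly) i j)^`(2) = (P2 *m Tpoly) i j + (P1 *m constM A) i j *+ 2.
  rewrite derivnS derivn1 e1 derivD deriv_mulT deriv_mul_constM mulr2n addrA.
  by congr ((_ *m _) i j + _ + _); apply/matrixP => k l; rewrite !mxE.
rewrite /scalar_op e2 e1 !mul_mx_diag.
rewrite 4![in LHS]mxE [X in X + _ + _ + _ + _]mxE [X in _ + X + _ + _ + _]mxE.
rewrite [X in _ + X + _ + _]mxE [X in _ + X + _]mxE [X in _ + X]mxE.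
rewrite [dt _ _]mxE [dc _ _]mxE -mul_polyC.
ring.
Qed.

Hypothesis sg_size : (size sg <= 3)%N.
Hypothesis tau_size : forall i, (size (tau i) <= 2)%N.
Hypothesis tau_diff : forall i j, A i j != 0 ->
  (size (sg *+ 2 + 'X * (tau j - tau i))%R <= 2)%N.
Hypothesis c_diff : forall i j, A i j != 0 ->
  (size (tau j + 'X * (c j - c i)%:P)%R <= 1)%N.

(** The coefficient of order [k] has degree at most [k]. By [conj_diagE] the off-diagonal entries
    are [A i j] times [2 sg + x (tau j - tau i)] and [tau j + x (c j - c i)]; [tau_diff] and
    [c_diff] cancel their top terms. *)
Lemma bochner_op_size k i j : (size ((nth 0%R bochner_op k : mpoly) i j) <= k.+1)%N.
Proof.
case: k => [|[|[|k]]] /=.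
- rewrite mxE conj_diagE mul_mx_diag [X in X + _]mxE !mxE addrCA.
  rewrite (leq_trans (size_polyD _ _)) // geq_max; apply/andP; split.
    by case: (i == j); rewrite ?mulr0n ?size_poly0 ?mulr1n ?size_polyC_leq1.
  rewrite -polyCB mul_polyC -scalerDr.
  have [->|Aij] := eqVneq (A i j) 0; first by rewrite scale0r size_poly0.
  by rewrite (leq_trans (size_scale_leq _ _)) // c_diff.
- rewrite mxE conj_diagE [X in X + _]mxE !mxE addrCA.
  rewrite (leq_trans (size_polyD _ _)) // geq_max; apply/andP; split.
    by case: (i == j); rewrite ?mulr0n ?size_poly0 ?mulr1n ?tau_size.
  rewrite [_ * (A i j)%:P]mulrC mul_polyC -scalerDr.
  have [->|Aij] := eqVneq (A i j) 0; first by rewrite scale0r size_poly0.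
  by rewrite (leq_trans (size_scale_leq _ _)) // tau_diff.
- by rewrite mxE; case: (i == j); rewrite ?mulr0n ?size_poly0 ?mulr1n.
- by rewrite nth_nil mxE size_poly0.
Qed.

Lemma size_act (D : diffop R N) (P : mpoly) n :
  (forall k i j, (size ((nth 0%R D k : mpoly) i j) <= k.+1)%N) ->
  (forall i j, (size (P i j) <= n)%N) -> forall i j, (size (act P D i j) <= n)%N.
Proof.
move=> sD sP i j; rewrite /act summxE (leq_trans (size_sum _ _ _)) //.
apply/bigmax_leqP => k _; rewrite mxE (leq_trans (size_sum _ _ _)) //.
apply/bigmax_leqP => l _; rewrite mxE.
have [->|p0] := eqVneq ((P i l)^`(k)) 0; first by rewrite mul0r size_poly0.
rewrite (leq_trans (size_polyMleq _ _)) //.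
(* Differentiation lowers the size strictly only for nonzero polynomials, which is why a zero
   derivative was split off. *)
have : (size ((P i l)^`(k))%R + k <= n)%N.
  elim: (nat_of_ord k) p0 => [|m IH] p0; first by rewrite addn0 sP.
  have pm0 : (P i l)^`(m) != 0.
    by apply: contraNneq p0 => pm; rewrite derivnS pm linear0.
  by rewrite addnS -addSn (leq_trans _ (IH pm0)) // leq_add2r derivnS lt_size_deriv.
move=> H; rewrite -subn1 leq_subLR add1n.
by apply: (leq_trans (leq_add (leqnn _) (sD k l j))); rewrite addnS ltnS.
Qed.

Lemma bochner_op_order : sg != 0 -> (0 < N)%N -> has_order bochner_op 2.
Proof.
move=> sg0 N0; split=> [|[|[|[|j]]] //= _]; last by rewrite nth_nil.
apply: contraNneq sg0 => /(congr1 (fun M : mpoly => M (Ordinal N0) (Ordinal N0))).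
by rewrite /= !mxE eqxx mulr1n => ->.
Qed.

Variable L : 'I_N -> {scalar {poly C}}.
Hypothesis L_pearson : forall i, pearson sg (tau i) (L i).
Hypothesis sg_real : pconj sg = sg.
Hypothesis tau_real : forall i, pconj (tau i) = tau i.
Hypothesis c_real : forall i, conjc (c i) = c i.

(** Green's identity: the difference of the Pearson equations at [f' g] and [f g'], in which the
    terms [sg f' g'] cancel. *)
Lemma scalar_op_sym i f g : L i (scalar_op i f * g) = L i (f * scalar_op i g).
Proof.
have e1 := L_pearson i (f^`() * g); have e2 := L_pearson i (f * g^`()).
rewrite !derivM in e1 e2.
apply/eqP; rewrite -subr_eq0 -linearB /=; apply/eqP.
rewrite -[RHS](subrr 0) -{1}e1 -e2 -linearB /=; congr (L i _).
rewrite /scalar_op -!mul_polyC !derivnS !derivn0; ring.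
Qed.

Lemma scalar_op_conj i f : pconj (scalar_op i f) = scalar_op i (pconj f).
Proof.
rewrite /scalar_op !derivnS !derivn0 !rmorphD !rmorphM /= sg_real tau_real.
by rewrite map_polyZ /= c_real !deriv_map.
Qed.

Lemma bochner_op_sym P Q :
  wip L Tpoly (act P bochner_op) Q = wip L Tpoly P (act Q bochner_op).
Proof.
apply/matrixP => r s; rewrite !mxE; apply: eq_bigr => j _.
by rewrite !bochner_op_T scalar_op_conj scalar_op_sym.
Qed.
End Operator.

(** * The Darboux relation forces a singular [Cn] *)

Section NotDarboux.
Variables (om L : 'I_N -> {scalar {poly C}}) (sg : {poly C}) (tau : 'I_N -> {poly C}).
Hypothesis om_pos : forall i, posdef (om i).
Hypothesis om_herm : forall i, hermitian (om i).
Hypothesis L_pos : forall i, posdef (L i).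
Hypothesis L_herm : forall i, hermitian (L i).
Hypothesis L_pearson : forall i, pearson sg (tau i) (L i).
Hypothesis sg0 : sg != 0.
Hypothesis no_ratio : forall j k, j != k -> forall P1 P2 : {poly C},
  P1 != 0 -> P2 != 0 ->
  sg * (P1^`() * P2 - P1 * P2^`()) + (tau j - tau k) * P1 * P2 != 0.

(** The leading coefficient is the identity, so an off-diagonal entry has degree below [n] and may
    itself be placed at [(i, j)] as a test polynomial; its norm under [om j] is then zero. *)
Lemma mop_diag n P i j : mop om 1%:M n P -> i != j -> P i j = 0.
Proof.
move=> [[sP mP] oP] ij; apply/eqP; apply: contraT => /(om_pos j).
have /oP /(congr1 (fun M : 'M[C]_N => M i i)) :
    forall r s, (size ((P i j *: delta_mx i j : mpoly) r s) <= n)%N.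
  move=> r s; rewrite !mxE; case: (_ && _); last by rewrite mulr0 size_poly0.
  rewrite mulr1; apply/leq_sizeP => k; rewrite leq_eqVlt => /predU1P[<-|nk].
    by have := congr1 (fun M : 'M[C]_N => M i j) mP; rewrite !mxE (negPf ij).
  by rewrite nth_default // (leq_trans (sP i j)).
rewrite !mxE (bigD1 j) //= big1 => [|k kj].
  by rewrite !mulmx1 !mxE !eqxx mulr1 addr0 => ->; rewrite ltxx.
by rewrite !mulmx1 !mxE (negPf kj) andbF mulr0 rmorph0 mulr0 linear0.
Qed.

(** The test polynomial [V] is chosen so that [V T] is [x^m] times the conjugate of [d] at position
    [(i, j)]. The extra unit in the bound pays for [T^-1], of degree one. *)
Lemma mop_T_orth n Q (d : {poly C}) i j (K : 'M[C]_N) m :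
  mop L Tpoly n Q -> (m + (size d).+1 <= n)%N ->
  L j ('X^m * (d *: (constM K *m Q *m Tpoly)) i j) = 0.
Proof.
move=> [_ oQ] mn; pose V : mpoly := ('X^m * pconj d) *: (delta_mx i j *m Tinv).
have /oQ VQ : forall r s, (size (V r s) <= n)%N.
  move=> r s; rewrite mxE (leq_trans (size_polyMleq _ _)) //.
  have sV : (size ((delta_mx i j *m Tinv : mpoly) r s) <= 2)%N.
    rewrite mxE (leq_trans (size_sum _ _ _)) //; apply/bigmax_leqP => l _.
    rewrite !mxE; case: (_ && _); last by rewrite mul0r size_poly0.
    rewrite mul1r (leq_trans (size_polyD _ _)) // geq_max size_polyN; apply/andP; split.
      by case: (_ == _); rewrite ?mulr0n ?size_poly0 // mulr1n size_poly1.
    by rewrite mulrC mul_polyC (leq_trans (size_scale_leq _ _)) // size_polyX.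
  have sX : (size ('X^m * pconj d)%R <= m + size d)%N.
    rewrite (leq_trans (size_polyMleq _ _)) // size_polyXn /=.
    by rewrite leq_add2l size_poly.
  rewrite -subn1 leq_subLR add1n (leq_trans (leq_add sX sV)) //.
  by rewrite addn2 ltnS -addnS.
have VT : V *m Tpoly = ('X^m * pconj d) *: delta_mx i j.
  by rewrite -scalemxAl -mulmxA TinvK mulmx1.
have := wip_constMl L Tpoly K Q V; rewrite VQ mulmx0.
move/(congr1 (fun M : 'M[C]_N => M i i)); rewrite [RHS]mxE => <-.
rewrite [RHS]mxE (bigD1 j) //= big1 => [|k kj].
  rewrite addr0 VT; move: (_ *m Tpoly) => B.
  rewrite !mxE !eqxx mulr1 rmorphM /= pconjK map_polyXn; congr (L j _); ring.
by rewrite VT !mxE (negPf kj) andbF mulr0 rmorph0 mulr0 linear0.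
Qed.

Variables (P Q : nat -> mpoly) (Cn : nat -> 'M[C]_N) (D : diffop R N) (F : mpoly).
Variables (i0 j0 : 'I_N) (n0 : nat).
Hypothesis Ai0j0 : A i0 j0 != 0.
Hypothesis P_mop : forall n, mop om 1%:M n (P n).
Hypothesis Q_mop : forall n, mop L Tpoly n (Q n).
Hypothesis F_unit : toR F \in unitmx.
Hypothesis CQ_eq : forall n, toR (constM (Cn n) *m Q n) =
  toR (act (P n) D) *m invmx (toR F).
Hypothesis Cn_unit : Cn n0 \in unitmx.

Lemma darboux_false : False.
Proof.
(* Since [F^-1] is the adjugate divided by [d], multiplying by [d] leaves polynomial coefficients
   only. *)
pose d := \det F.
have d0 : d != 0.
  by move: F_unit; rewrite unitmxE det_map_mx unitfE tofrac_eq0.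
pose E := [seq (G : mpoly) *m (\adj F *m Tpoly) | G <- D].
pose M n := d *: (constM (Cn n) *m Q n *m Tpoly).
have ME n : M n = act (P n) E.
  rewrite -act_mulr /M mulmxA scalemxAl; congr (_ *m _).
  have -> : act (P n) D = constM (Cn n) *m Q n *m F.
    apply/matrixP => i j; apply/eqP; rewrite -tofrac_eq; apply/eqP.
    have := congr1 (fun M => (M *m toR F) i j) (CQ_eq n).
    by rewrite mulmxKV // -map_mxM !mxE.
  by rewrite -mulmxA mul_mx_adj mul_mx_scalar.
have P_monic i : monic_seq (fun n => P n i i).
  move=> n; have [[sP mP] _] := P_mop n; split => //.
  by have := congr1 (fun M : 'M[C]_N => M i i) mP; rewrite !mxE eqxx.
have P_orth i n m : n != m -> om i (P n i i * pconj (P m i i)) = 0.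
  move=> nm; have := wip_mop_neq om_herm (P_mop n) (P_mop m) nm.
  move/(congr1 (fun M : 'M[C]_N => M i i)); rewrite !mxE (bigD1 i) //= big1.
    by rewrite !mulmx1 addr0.
  move=> k ki; rewrite !mulmx1 (mop_diag (P_mop n)) 1?eq_sym //.
  by rewrite mul0r linear0.
have M_orth i j m : exists K, forall n, (K <= n)%N -> L j ('X^m * M n i j) = 0.
  by exists (m + (size d).+1)%N => n; exact: mop_T_orth.
have uniq := darboux_entry_unique om_pos L_pos L_pearson sg0 no_ratio
  (fun n i j => mop_diag (P_mop n)) P_monic P_orth ME M_orth.
(* [k] is a column where row [r] is nonzero for some [n]; if there is none, any index serves, here
   [i0]. *)
have row_supp r : exists k, forall j, j != k -> M n0 r j = 0.
  have [[k [n Mk]]|H] := pselect (exists k n, M n r k <> 0); last first.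
    exists i0 => j _; apply: contrapT => Mj; apply: H; by exists j, n0.
  exists k => j jk; have [//|Mk0] := uniq r _ _ jk.
  by case: Mk.
have [[sQ mQ] _] := Q_mop n0.
pose X := constM (Cn n0) *m Q n0.
have sX r j : (size (X r j) <= n0.+1)%N by exact: size_constM_mul.
have Cn0E r j : Cn n0 r j = (X r j)`_n0.
  by rewrite -[in LHS](coef_constM_mul (Cn n0) (conj sQ mQ)) mxE.
(* Multiplication by [T^-1 = 1 - x A] recovers [d X] from [M]; a row supported on column [k] meets
   only row [k] of [A]. *)
have MX r k : (forall j, j != k -> M n0 r j = 0) ->
    forall j, d * X r j = M n0 r j - 'X * M n0 r k * (A k j)%:P.
  move=> Mk j; have <- : (M n0 *m Tinv) r j = d * X r j.
    by rewrite /M -/X -scalemxAl -(mulmxA X) TpolyK mulmx1 mxE.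
  rewrite /Tinv mulmxBr mulmx1 -scalemxAr mxE [X in _ + X]mxE [X in _ - X]mxE.
  congr (_ - _); rewrite -mulrA; congr (_ * _).
  rewrite mxE (bigD1 k) //= big1 ?addr0 ?mxE // => l lk.
  by rewrite Mk // mul0r.
have Ai0 : A i0 i0 = 0 by have /eqP := A_nil i0 i0 i0; rewrite mulf_eq0 orbb => /eqP.
have ij : j0 != i0 by apply: contraNneq Ai0j0 => ->; rewrite Ai0.
(* If the row is supported on [i0], then [X r j0 = - A i0 j0 x X r i0]; since [X r j0] has degree at
   most [n0], the coefficient of degree [n0] of [X r i0] is zero. Otherwise [A k i0 = 0], because
   [A i0 j0] is nonzero, and [X r i0] itself vanishes. *)
have C0 r : Cn n0 r i0 = 0.
  have [k Mk] := row_supp r; have MXr := MX r k Mk; rewrite Cn0E.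
  have [ki|ki] := eqVneq k i0.
    subst k; have := MXr j0; rewrite Mk // sub0r.
    have := MXr i0; rewrite Ai0 mulr0 subr0 => <- XE.
    have {}XE : X r j0 = - (A i0 j0 *: ('X * X r i0)).
      by apply: (mulfI d0); rewrite XE -mul_polyC; ring.
    have := congr1 (fun p : {poly C} => p`_n0.+1) XE.
    rewrite (nth_default 0 (sX _ _)) coefN coefZ coefXM /= => /esym/eqP.
    by rewrite oppr_eq0 mulf_eq0 (negPf Ai0j0) /= => /eqP.
  have := MXr i0; rewrite Mk 1?eq_sym //.
  have -> : A k i0 = 0.
    by have /eqP := A_nil k i0 j0; rewrite mulf_eq0 (negPf Ai0j0) orbF => /eqP.
  rewrite mulr0 subr0 => /eqP; rewrite mulf_eq0 (negPf d0) => /eqP ->.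
  by rewrite coef0.
have /(congr1 (fun M : 'M[C]_N => M i0 i0)) := mulVmx Cn_unit.
rewrite !mxE eqxx big1 => [/eqP|k _]; last by rewrite C0 mulr0.
by rewrite eq_sym oner_eq0.
Qed.
End NotDarboux.
End Nilpotent.

(** * Integration over an exhausted interval *)

Section Exhaustion.
Variable R : realType.
Local Notation mu := (@lebesgue_measure R).
Local Open Scope classical_set_scope.

(** A common treatment of the line, the half-line and the bounded interval: growing compact
    intervals, on each of which the fundamental theorem of calculus applies. *)
Record exhaustion (I : set R) (a b : nat -> R) : Prop := Exhaustion {
  exh_lt : forall n, a n < b n;
  exh_a : forall n m, (n <= m)%N -> a m <= a n;
  exh_b : forall n m, (n <= m)%N -> b n <= b m;
  exh_sub : forall n x, a n <= x <= b n -> I x;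
  exh_cover : forall x, I x -> exists n, a n <= x <= b n }.

Variables (I : set R) (a b : nat -> R).
Hypothesis exh : exhaustion I a b.

Let J n : set R := `[a n, b n].

Let JE n x : J n x = (a n <= x <= b n) :> Prop.
Proof. by rewrite /J /= in_itv. Qed.

Lemma exhaustion_bigcup : I = \bigcup_n J n.
Proof.
apply/seteqP; split=> x.
  by move=> /(exh_cover exh) [n xn]; exists n => //; rewrite JE.
by case=> n _; rewrite JE; exact: exh_sub exh _ _.
Qed.

Lemma exhaustion_measurable : measurable I.
Proof. rewrite exhaustion_bigcup; apply: bigcup_measurable => n _; exact: measurable_itv. Qed.

Lemma exhaustion_nondecreasing : nondecreasing_seq J.
Proof.
move=> n m nm; rewrite subsetEset => x; rewrite !JE => /andP[h1 h2].
by rewrite (le_trans (exh_a exh nm) h1) (le_trans h2 (exh_b exh nm)).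
Qed.

Variables (f F : R -> R).
Hypothesis dF : forall x, I x -> is_derive x 1 F (f x).
Hypothesis cf : forall x, I x -> {for x, continuous f}.

Lemma exhaustion_measurable_fun : measurable_fun I f.
Proof.
rewrite exhaustion_bigcup; apply/measurable_fun_bigcup => n; first exact: measurable_itv.
apply: subspace_continuous_measurable_fun; first exact: measurable_itv.
apply: continuous_in_subspaceT => x; rewrite inE JE => xJ.
exact: cf (exh_sub exh xJ).
Qed.

Lemma exhaustion_FTC n : (\int[mu]_(x in J n) (f x)%:E = (F (b n) - F (a n))%:E)%E.
Proof.
have cF x : a n <= x <= b n -> {for x, continuous F}.
  move=> xJ; apply: differentiable_continuous; apply/derivable1_diffP.
  by have [] := dF (exh_sub exh xJ).
have ab := exh_lt exh n.
rewrite (@continuous_FTC2 _ f F) ?EFinB //.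
- apply: continuous_in_subspaceT => x; rewrite inE /= in_itv /= => xJ.
  exact: cf (exh_sub exh xJ).
- split.
  + move=> x; rewrite in_itv /= => /andP[/ltW h1 /ltW h2].
    by have [] := dF (exh_sub exh (n := n) (x := x) _); rewrite ?h1.
  + by apply: cvg_at_right_filter; apply: cF; rewrite lexx ltW.
  + by apply: cvg_at_left_filter; apply: cF; rewrite lexx ltW.
- move=> x; rewrite in_itv /= => /andP[/ltW h1 /ltW h2].
  rewrite derive1E; have [] := dF (exh_sub exh (n := n) (x := x) _) => //.
  by rewrite h1.
Qed.

(** Monotone convergence: the integral over each [J n] is a difference of two values of [F], hence
    at most [2 M]. *)
Lemma exhaustion_ge0_integrable (M : R) : (forall x, I x -> 0 <= f x) ->
  (forall x, I x -> `|F x| <= M) -> mu.-integrable I (EFin \o f).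
Proof.
move=> f0 FM; apply/integrableP; split.
  by apply/measurable_EFinP; exact: exhaustion_measurable_fun.
apply: (@le_lt_trans _ _ (M + M)%:E); last exact: ltry.
have -> : (\int[mu]_(x in I) `|(EFin \o f) x| = \int[mu]_(x in I) (f x)%:E)%E.
  by apply: eq_integral => x; rewrite inE => Ix /=; rewrite ger0_norm ?f0.
rewrite exhaustion_bigcup.
have H : (\int[mu]_(x in J n) (f x)%:E)%E @[n --> \oo] -->
    (\int[mu]_(x in \bigcup_n J n) (f x)%:E)%E.
  apply: ge0_nondecreasing_set_cvg_integral.
  - exact: exhaustion_nondecreasing.
  - by move=> n; exact: measurable_itv.
  - move=> n; apply/measurable_EFinP.
    apply: measurable_funS exhaustion_measurable_fun; first exact: exhaustion_measurable.
    by move=> x; rewrite JE; exact: exh_sub exh _ _.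
  - move=> n x; rewrite JE => /(exh_sub exh) Ix.
    by rewrite lee_fin f0.
rewrite -(cvg_lim _ H) //; apply: lime_le; first by apply/cvg_ex; eexists; exact: H.
apply: nearW => n; rewrite exhaustion_FTC lee_fin.
have h c : a n <= c <= b n -> `|F c| <= M by move=> /(exh_sub exh); exact: FM.
have ab := ltW (exh_lt exh n).
apply: (le_trans (ler_norm _)); apply: (le_trans (ler_normB _ _)).
by apply: lerD; apply: h; rewrite lexx ?ab.
Qed.

(** Dominated convergence for the truncations of [f] to [J n], whose integrals [F (b n) - F (a n)]
    tend to 0. *)
Lemma exhaustion_integral0 : mu.-integrable I (EFin \o f) ->
  F (a n) @[n --> \oo] --> 0 -> F (b n) @[n --> \oo] --> 0 ->
  (\int[mu]_(x in I) (f x)%:E = 0)%E.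
Proof.
move=> intf Fa Fb.
have mI := exhaustion_measurable.
have JI n : J n `<=` I.
  by move=> x; rewrite JE; exact: exh_sub exh _ _.
have mf : measurable_fun I (EFin \o f) 
  by apply/measurable_EFinP; exact: exhaustion_measurable_fun.
pose fn n := (EFin \o f) \_ (J n).
have mfn n : measurable_fun I (fn n).
  apply/(measurable_restrict (EFin \o f)) => //; first exact: measurable_itv.
  apply: measurable_funS mf => //; exact: subIsetl.
have fnf : {ae mu, forall x, I x -> fn ^~ x @ \oo --> (EFin \o f) x}.
  (* Each point lies in [J n] from some index on, so the truncations are eventually constant
     there. *)
  apply: aeW => x Ix /=; apply: cvg_near_cst.
  have [n0 xn] := exh_cover exh Ix; exists n0 => // n /= n0n.
  rewrite /fn patchE mem_set //.
  have := exhaustion_nondecreasing n0n; rewrite subsetEset; apply.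
  by rewrite JE.
have fnle : {ae mu, forall x n, I x -> (`|fn n x| <= (abse \o (EFin \o f)) x)%E}.
  apply: aeW => x n Ix; rewrite /fn patchE; case: ifP => _ //=.
  by rewrite normr0 lee_fin.
have [_ _ H] := @dominated_convergence _ _ R mu I mI fn _ _ mfn mf fnf
  (integrable_abse intf) fnle.
have H' : (F (b n) - F (a n))%:E @[n --> \oo] --> (\int[mu]_(x in I) (f x)%:E)%E.
  apply: cvg_trans H; apply: near_eq_cvg; apply: nearW => n /=.
  rewrite -exhaustion_FTC -[in RHS](setIidr (JI n)) -integral_mkcondr //.
rewrite -(cvg_lim _ H') //; apply/cvg_lim => //.
apply: cvg_EFin; first by apply: nearW.
rewrite -(subr0 0); exact: cvgB.
Qed.
End Exhaustion.

(** * Moment functionals of positive weights *)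

Section ComplexIntegral.
Local Open Scope classical_set_scope.
Variables (R : realType) (I : set R).
Local Notation C := R[i].
Local Notation pconj := (map_poly (@conjc R)).
Local Notation mu := (@lebesgue_measure R).
Hypothesis mI : measurable I.

(** Integrability and value are kept together, so that linearity carries both at once. *)
Definition rint (f : R -> R) (v : R) : Prop :=
  mu.-integrable I (EFin \o f) /\ (\int[mu]_(x in I) (f x)%:E = v%:E)%E.

Lemma rintD f g u v : rint f u -> rint g v -> rint (fun x => f x + g x) (u + v).
Proof.
move=> [intf If] [intg Ig]; split.
  by rewrite (_ : _ \o _ = (EFin \o f) \+ (EFin \o g))%E //; exact: integrableD.
under eq_integral do rewrite EFinD.
by rewrite integralD // If Ig EFinD.
Qed.

Lemma rintZ c f u : rint f u -> rint (fun x => c * f x) (c * u).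
Proof.
move=> [intf If]; split.
  by rewrite (_ : _ \o _ = fun x => c%:E * (EFin \o f) x)%E //; exact: integrableZl.
under eq_integral do rewrite EFinM.
by rewrite integralZl // If EFinM.
Qed.

Lemma rint0 : rint (fun=> 0) 0.
Proof. by split; [exact: integrable0 | exact: integral0]. Qed.

Definition cint (f : R -> C) (v : C) : Prop :=
  rint (fun x => complex.Re (f x)) (complex.Re v) /\
  rint (fun x => complex.Im (f x)) (complex.Im v).

Lemma cint_zeroE f : cint_zero I f <-> cint f 0.
Proof. by split => [[? [? [? ?]]]|[[? ?] [? ?]]]; split. Qed.

Lemma cint_eq f g v : f =1 g -> cint f v -> cint g v.
Proof. by move=> /funext ->. Qed.

Lemma cint_unique f u v : cint f u -> cint f v -> u = v.
Proof.
case: u v => [a b] [c d] [[_ H1] [_ H2]] [[_ H3] [_ H4]].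
move: H1 H2 H3 H4 => /= -> -> [ac] [bd]; by rewrite ac bd.
Qed.

Lemma cintD f g u v : cint f u -> cint g v -> cint (fun x => f x + g x) (u + v).
Proof.
move=> [f1 f2] [g1 g2]; have := rintD f1 g1; have := rintD f2 g2.
case: u v {f1 f2 g1 g2} => [a b] [c d] /= h2 h1; split => /=.
  rewrite (_ : (fun x => _) = (fun x => complex.Re (f x) + complex.Re (g x))) //.
  by apply/funext => x; case: (f x) (g x) => [? ?] [? ?].
rewrite (_ : (fun x => _) = (fun x => complex.Im (f x) + complex.Im (g x))) //.
by apply/funext => x; case: (f x) (g x) => [? ?] [? ?].
Qed.

Lemma cintZ c f u : cint f u -> cint (fun x => c * f x) (c * u).
Proof.
move=> [f1 f2]; case: c => a b.
have := rintD (rintZ a f1) (rintZ (- b) f2); have := rintD (rintZ a f2) (rintZ b f1).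
case: u {f1 f2} => [c d] /= h2 h1; split => /=.
  rewrite -mulNr; move: h1; congr rint; apply/funext => x; case: (f x) => u v /=.
  by rewrite mulNr.
by move: h2; congr rint; apply/funext => x; case: (f x) => u v /=.
Qed.

Lemma cint0 : cint (fun=> 0) 0.
Proof. by split; exact: rint0. Qed.

Lemma cint_sum J (r : seq J) (f : J -> R -> C) (v : J -> C) :
  (forall j, cint (f j) (v j)) ->
  cint (fun x => \sum_(j <- r) f j x) (\sum_(j <- r) v j).
Proof.
move=> H; elim: r => [|j r IH].
  by rewrite big_nil; apply: cint_eq cint0 => x; rewrite big_nil.
by rewrite big_cons; apply: cint_eq (cintD (H j) IH) => x; rewrite big_cons.
Qed.

Lemma RtoCE (x : R) : RtoC x = real_complex R x. Proof. by []. Qed.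

Lemma cint_real f v : rint f v -> cint (fun x => RtoC (f x)) (RtoC v).
Proof. by move=> H; split => //=; exact: rint0. Qed.

Record moment_weight (w : R -> R) : Prop := MomentWeight {
  mw_gt0 : forall x, I x -> 0 < w x;
  mw_int : forall k, mu.-integrable I (EFin \o (fun x => x ^+ k * w x)) }.

Definition moment (w : R -> R) k : R := fine (\int[mu]_(x in I) (x ^+ k * w x)%:E)%E.

(** Built from the moments, the functional is linear for every [w]; [cint_mom] identifies it with
    the integral once the moments exist. *)
Definition mom (w : R -> R) (p : {poly C}) : C :=
  \sum_(k < size p) p`_k * RtoC (moment w k).

Lemma mom_wide w (p : {poly C}) n : (size p <= n)%N ->
  mom w p = \sum_(k < n) p`_k * RtoC (moment w k).
Proof.
move=> spn; rewrite /mom (big_ord_widen _ (fun k => p`_k * RtoC (moment w k)) spn).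
rewrite big_mkcond; apply: eq_bigr => k _; case: ltnP => // h.
by rewrite nth_default ?mul0r.
Qed.

Lemma mom_linear w : scalar (mom w).
Proof.
move=> c p q; pose n := maxn (size p) (size q).
have sp : (size p <= n)%N by exact: leq_maxl.
have sq : (size q <= n)%N by exact: leq_maxr.
have s3 : (size (c *: p + q)%R <= n)%N.
  by rewrite (leq_trans (size_polyD _ _)) // geq_max sq (leq_trans (size_scale_leq _ _)).
rewrite (mom_wide w s3) (mom_wide w sp) (mom_wide w sq) mulr_sumr -big_split /=.
by apply: eq_bigr => k _; rewrite coefD coefZ mulrDl mulrA.
Qed.

HB.instance Definition _ w :=
  GRing.isLinear.Build C {poly C} C _ (mom w) (mom_linear w).

Variable w : R -> R.
Hypothesis mw : moment_weight w.

Lemma cint_mom (p : {poly C}) : cint (fun x => p.[RtoC x] * RtoC (w x)) (mom w p).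
Proof.
pose f (k : 'I_(size p)) x : C := p`_k * RtoC (x ^+ k * w x).
apply: (@cint_eq (fun x => \sum_(k < size p) f k x)).
  move=> x; rewrite horner_coef mulr_suml; apply: eq_bigr => k _.
  rewrite /f -mulrA; congr (_ * _).
  by rewrite !RtoCE rmorphM rmorphXn.
apply: cint_sum => k; apply/cintZ/cint_real; split; first exact: (mw_int mw k).
by rewrite /moment fineK // integrable_fin_num //; exact: (mw_int mw k).
Qed.

Lemma mom_hermitian : hermitian (mom w).
Proof.
move=> p; rewrite (@mom_wide w _ (size p)) ?size_poly // rmorph_sum.
apply: eq_bigr => k _; rewrite coef_map rmorphM /=; congr (_ * _).
by rewrite /RtoC oppr0.
Qed.

Hypothesis I_pos : mu I != 0%E.

Lemma horner_conj_real (p : {poly C}) x : (pconj p).[RtoC x] = conjc p.[RtoC x].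
Proof. by rewrite -[in RHS](horner_map (@conjc R)) /= /RtoC /= oppr0. Qed.

Lemma normsq_horner (p : {poly C}) x : (p * pconj p).[RtoC x] =
  RtoC (complex.Re p.[RtoC x] ^+ 2 + complex.Im p.[RtoC x] ^+ 2).
Proof.
rewrite hornerM horner_conj_real.
by case: (p.[_]) => a b; apply/eqP; rewrite eq_complex /=; apply/andP; split; apply/eqP; ring.
Qed.

(** If the integral of [|p|^2 w] is zero, the integrand vanishes almost everywhere; as [w > 0] on
    [I], this set lies in a null set together with the finitely many real roots of [p], against
    [mu I != 0]. *)
Lemma mom_posdef : posdef (mom w).
Proof.
move=> p p0; have [] := cint_mom (p * pconj p).
pose g x := (complex.Re p.[RtoC x] ^+ 2 + complex.Im p.[RtoC x] ^+ 2) * w x.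
have gE x : (p * pconj p).[RtoC x] * RtoC (w x) = RtoC (g x).
  by rewrite normsq_horner !RtoCE -rmorphM.
under [X in rint X _]eq_fun do rewrite gE.
under [X in _ -> rint X _ -> _]eq_fun do rewrite gE.
case: (mom _ _) => a b /= [intg Ig] [_ I0].
have {I0} -> : b = 0 by move: I0; rewrite integral0 => -[].
rewrite ltcE /= eqxx /= lt_def.
have g0 x : I x -> 0 <= g x.
  by move=> Ix; rewrite mulr_ge0 ?addr_ge0 ?sqr_ge0 // ltW ?(mw_gt0 mw).
apply/andP; split; last by rewrite -lee_fin -Ig; apply: integral_ge0 => x /g0.
apply: contraNneq I_pos => a0.
have : ae_eq mu I (EFin \o g) (cst 0%E).
  apply/ae_eq_integral_abs => //; first by case/integrableP: intg.
  transitivity (a%:E : \bar R); last by rewrite a0.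
  rewrite -Ig; apply: eq_integral => x.
  by rewrite inE => Ix /=; rewrite ger0_norm // g0.
case=> Z [mZ Z0 HZ].
(* Over the complex numbers [p] splits into linear factors, so its real roots are real parts of
   members of a finite list. *)
have fin : finite_set [set x | root p (RtoC x)].
  have [r pr] := closed_field_poly_normal p.
  apply: (@sub_finite_set _ _ ((@complex.Re R) @` [set` r])).
    move=> x /= px; exists (RtoC x) => //=; move: px.
    by rewrite pr rootZ ?lead_coef_eq0 // root_prod_XsubC.
  by apply: finite_image; exact: finite_seq.
have sub : I `<=` Z `|` [set x | root p (RtoC x)].
  move=> x Ix; apply: contrapT => /not_orP [nZ nr]; apply: nZ; apply: HZ => /= H.
  have /eqP := H Ix; rewrite eqe /g mulf_eq0 (gt_eqF (mw_gt0 mw Ix)) orbF.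
  rewrite paddr_eq0 ?sqr_ge0 // !sqrf_eq0 => /andP[/eqP Re0 /eqP Im0]; apply: nr => /=.
  by rewrite /root; apply/eqP; move: Re0 Im0; case: (p.[_]) => u v /= -> ->.
have mfin : mu [set x | root p (RtoC x)] = 0%E.
  by apply: countable_lebesgue_measure0; exact: finite_set_countable.
have mS : measurable ([set x | root p (RtoC x)] : set R).
  by apply: countable_measurable => //; exact: finite_set_countable.
apply/eqP; apply: (@subset_measure0 _ _ _ mu _ _ _ _ sub) => //; first exact: measurableU.
exact: null_set_setU mZ mS Z0 mfin.
Qed.

End ComplexIntegral.

(** * From the integral form of orthogonality to [wip] *)

Section Bridge.
Local Open Scope classical_set_scope.
Variables (R : realType) (N : nat).
Local Notation C := R[i].
Local Notation pconj := (map_poly (@conjc R)).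
Local Notation mpoly := (mpoly R N).
Local Notation mu := (@lebesgue_measure R).

Lemma evalM_mul (P Q : mpoly) x : evalM (P *m Q) x = evalM P x *m evalM Q x.
Proof.
apply/matrixP => i j; rewrite !mxE horner_sum; apply: eq_bigr => k _.
by rewrite !mxE hornerM.
Qed.

Variables (I : set R) (w : 'I_N -> R -> R).
Hypothesis mI : measurable I.
Hypothesis mw : forall i, moment_weight I (w i).

Definition momL i : {scalar {poly C}} := mom I (w i).

(** Every entry of the matrix integrand has an integral, equal to the entry of [wip]; uniqueness of
    the value gives both directions. *)
Lemma orthWE (S P Q : mpoly) :
  orthW I (fun x => evalM S x *m diagW w x *m adjM (evalM S x)) P Q <->
  wip momL S P Q = 0.
Proof.
have H i j : cint I (fun x => (evalM P x *m (evalM S x *m diagW w x *m adjM (evalM S x))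
    *m adjM (evalM Q x)) i j) (wip momL S P Q i j).
  rewrite mxE; apply: (@cint_eq _ _ (fun x => \sum_k
     ((P *m S) i k * pconj ((Q *m S) j k)).[RtoC x] * RtoC (w k x))); last first.
    by apply: cint_sum => // k; exact: cint_mom.
  move=> x; rewrite !mulmxA -evalM_mul -mulmxA -adjMM -evalM_mul mul_mx_diag mxE.
  apply: eq_bigr => k _; rewrite !mxE hornerM horner_conj_real mulrAC.
  by rewrite mulrAC.
split=> [oPQ|W0].
  apply/matrixP => i j; rewrite [RHS]mxE.
  by apply: cint_unique (H i j) _; exact/cint_zeroE/oPQ.
by move=> i j; apply/cint_zeroE; have := H i j; rewrite W0 mxE.
Qed.

Lemma is_MOP_E (S : mpoly) (P : nat -> mpoly) :
  is_MOP I (fun x => evalM S x *m diagW w x *m adjM (evalM S x)) P <->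
  (forall n, monic_deg n (P n)) /\
  (forall n m, m <> n -> wip momL S (P n) (P m) = 0).
Proof.
split=> [H|[mP oP] n]; last by split => // m mn; apply/orthWE/oP.
by split=> [n|n m mn]; have [mPn oPn] := H n; [exact: mPn|exact/orthWE/oPn].
Qed.

End Bridge.

(** * The Pearson equation from the differential equation of the weight *)

Section MomentPearson.
Local Open Scope classical_set_scope.
Variables (R : realType) (I : set R) (a b : nat -> R).
Local Notation C := R[i].
Hypothesis exh : exhaustion I a b.
Variables (w w' : R -> R) (sg tau : {poly R}).
Hypothesis mw : moment_weight I w.
Hypothesis dw : forall x, I x -> is_derive x 1 w (w' x).
Hypothesis pw : forall x, I x -> sg.[x] * w' x = (tau - sg^`()).[x] * w x.
Hypothesis wa : forall k, (sg.[a n] * (a n ^+ k * w (a n))) @[n --> \oo] --> 0.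
Hypothesis wb : forall k, (sg.[b n] * (b n ^+ k * w (b n))) @[n --> \oo] --> 0.

Let mI : measurable I := exhaustion_measurable exh.

Lemma horner_RtoC (q : {poly R}) x :
  (map_poly (real_complex R) q).[RtoC x] = RtoC q.[x].
Proof. by rewrite RtoCE horner_map. Qed.

Lemma mom_real (q : {poly R}) v :
  rint I (fun x => q.[x] * w x) v -> mom I w (map_poly (real_complex R) q) = RtoC v.
Proof.
move=> H; apply: cint_unique (cint_mom mI mw _) _.
apply: cint_eq (cint_real H) => x.
by rewrite horner_RtoC !RtoCE rmorphM.
Qed.

Lemma rint_poly (q : {poly R}) : exists v, rint I (fun x => q.[x] * w x) v.
Proof.
have [H _] := cint_mom mI mw (map_poly (real_complex R) q).
eexists; move: H; congr rint.
by apply/funext => x; rewrite horner_RtoC !RtoCE -rmorphM.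
Qed.

(** By linearity monomials suffice, and these are real. The integrand is then the derivative of
    [sg x^k w], which tends to 0 at both ends by [wa] and [wb]. *)
Lemma mom_pearson :
  pearson (map_poly (real_complex R) sg) (map_poly (real_complex R) tau) (mom I w).
Proof.
have key k : mom I w (map_poly (real_complex R) (sg * ('X^k)^`() + tau * 'X^k)) = 0.
  rewrite (_ : 0 = RtoC 0) //; apply: mom_real.
  set q := _ + _; have [v [intq _]] := rint_poly q.
  split => //.
  pose F x := (sg * 'X^k).[x] * w x.
  apply: (exhaustion_integral0 exh (F := F)) => //.
  - move=> x Ix; have d1 : is_derive x (1 : R) (horner (sg * 'X^k)) ((sg * 'X^k)^`().[x]).
      exact: is_derive_poly.
    have := is_deriveM d1 (dw Ix); rewrite /F => H.
    apply: is_derive_eq H _.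
    have := pw Ix; rewrite /q /GRing.scale /= derivM => pwx.
    transitivity ((sg^`() * 'X^k + sg * ('X^k)^`()).[x] * w x + ('X^k).[x] * (sg.[x] * w' x)).
      by rewrite !hornerM; ring.
    by rewrite pwx !(hornerD, hornerN, hornerM); ring.
  - move=> x Ix; apply: cvgM.
      by apply: differentiable_continuous; apply/derivable1_diffP; exact: derivable_horner.
    apply: differentiable_continuous; apply/derivable1_diffP.
    by have [] := dw Ix.
  - apply: cvg_trans (wa k); apply: near_eq_cvg; apply: nearW => n.
    by rewrite /F hornerM hornerXn -mulrA.
  - apply: cvg_trans (wb k); apply: near_eq_cvg; apply: nearW => n.
    by rewrite /F hornerM hornerXn -mulrA.
move=> p; rewrite -[p]coefK poly_def linear_sum mulr_sumr mulr_sumr -big_split linear_sum.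
rewrite big1 // => k _ /=.
rewrite derivZ -!scalerAr -scalerDr linearZ /=.
have := key k; rewrite rmorphD !rmorphM /= map_polyXn -deriv_map map_polyXn => ->.
by rewrite mulr0.
Qed.
End MomentPearson.

(** * Reduction to the data of the scalar weights *)

Section Assembly.
Local Open Scope classical_set_scope.
Variables (R : realType) (N : nat).
Local Notation C := R[i].
Local Notation mpoly := (mpoly R N).
Local Notation mu := (@lebesgue_measure R).
Local Notation toC := (map_poly (real_complex R)).
Variable a : nat -> R.
Local Notation A := (Amat N a).

(** Indices start at 0 here, so the nonzero entries lie in even rows and odd columns. No index is
    both, which is why the products in [Amat_nil] vanish. *)
Lemma Amat_parity (i j : 'I_N) : A i j != 0 -> ~~ odd i /\ odd j.
Proof.
rewrite mxE; case: ifP => [/andP[ei /eqP ->] _|_]; first by rewrite /= ei.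
case: ifP => [/andP[/andP[ei i2] /eqP ->] _|_]; last by rewrite eqxx.
by split=> //; move: ei i2; case: (nat_of_ord i) => [|[|k]] //=; rewrite !negbK.
Qed.

Lemma Amat_nil i k j : A i k * A k j = 0.
Proof.
apply/eqP; rewrite mulf_eq0; apply/norP => -[/Amat_parity[_ ok] /Amat_parity[]].
by rewrite ok.
Qed.

Lemma Tmat_poly x : Tmat N a x = evalM (Tpoly A) x.
Proof.
apply/matrixP => i j; rewrite [LHS]mxE [RHS]mxE [X in X.[_]]mxE hornerD.
congr (_ + _); first by rewrite !mxE; case: (i == j); rewrite ?mulr1n ?mulr0n ?hornerE.
have cE : constM A i j = (A i j)%:P by rewrite [LHS]mxE.
by rewrite [LHS]mxE [X in X.[_]]mxE cE hornerM hornerX hornerC.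
Qed.

Lemma Wsym_poly (w : 'I_N -> R -> R) : Wsym a w =
  fun x => evalM (Tpoly A) x *m diagW w x *m adjM (evalM (Tpoly A) x).
Proof. by apply/funext => x; rewrite /Wsym Tmat_poly. Qed.

Lemma diagW_poly (w : 'I_N -> R -> R) : diagW w =
  fun x => evalM 1%:M x *m diagW w x *m adjM (evalM 1%:M x).
Proof.
apply/funext => x.
have -> : evalM 1%:M x = 1%:M :> 'M[C]_N.
  by apply/matrixP => i j; rewrite !mxE; case: (i == j); rewrite ?mulr1n ?mulr0n ?hornerE.
by rewrite mul1mx /adjM map_mx1 trmx1 mulmx1.
Qed.

Hypothesis hN : (2 <= N)%N.
Hypothesis ha : forall k : nat, (0 < k < N)%N -> a k != 0.
Variables (I : set R) (w : 'I_N -> R -> R) (sg : {poly R}) (tau : 'I_N -> {poly R}) (e : R).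
Hypothesis mI : measurable I.
Hypothesis I_pos : mu I != 0%E.
Hypothesis mw : forall i, moment_weight I (w i).
Hypothesis pw : forall i, pearson (toC sg) (toC (tau i)) (mom I (w i)).
Hypothesis sg0 : sg != 0.
Hypothesis sg_size : (size sg <= 3)%N.
Hypothesis tau_size : forall i, (size (tau i) <= 2)%N.
Hypothesis tau_diff : forall i j : 'I_N, ~~ odd i -> odd j ->
  (size (sg *+ 2 + 'X * (tau j - tau i))%R <= 2)%N.
Hypothesis tau_lead : forall j : 'I_N, odd j -> (size (tau j - e *: 'X)%R <= 1)%N.

(** For even [i] and odd [j] this makes [tau j + x (c j - c i)] equal to [tau j - e x], a constant
    by [tau_lead]. *)
Let c (i : 'I_N) : C := if odd i then 0 else RtoC e.
Let D := bochner_op A (toC sg) (fun i => toC (tau i)) c.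

Let L := momL I w.
Let L_pos i : posdef (L i) := mom_posdef mI (mw i) I_pos.
Let L_herm i : hermitian (L i) := @mom_hermitian R I (w i).

Lemma toC_conj (q : {poly R}) : map_poly (@conjc R) (toC q) = toC q.
Proof. by apply/polyP => k; rewrite !coef_map /= oppr0. Qed.

Lemma bochner_solution : exists D : diffop R N, has_order D 2 /\ in_DW I (Wsym a w) D.
Proof.
exists D; split.
  by apply: bochner_op_order; rewrite ?map_poly_eq0 // ltnW.
have TK := TpolyK Amat_nil.
have /choice [P HP] := mop_exists L_pos L_herm TK.
exists P; split.
  rewrite Wsym_poly; apply/(is_MOP_E mI mw); split=> [n|n m mn]; first by have [] := HP n.
  have nm : n != m by apply/eqP => nm; apply: mn.
  exact: (wip_mop_neq L_herm (HP n) (HP m) nm).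
have D_size k i j : (size ((nth 0%R D k : mpoly) i j) <= k.+1)%N.
  apply: bochner_op_size; rewrite ?size_map_poly // => {k}.
  - exact: Amat_nil.
  - by move=> k; rewrite size_map_poly.
  - move=> {}i {}j /Amat_parity [ei oj].
    rewrite -rmorphMn -rmorphB /= -(map_polyX (real_complex R)) -rmorphM.
    by rewrite -rmorphD size_map_poly; exact: tau_diff.
  - move=> {}i {}j /Amat_parity [ei oj]; rewrite /c oj (negPf ei) sub0r.
    have -> : (- RtoC e)%:P = toC (- e)%:P 
      by rewrite map_polyC; congr (_%:P); apply/eqP; rewrite eq_complex /= oppr0 !eqxx.
    rewrite -(map_polyX (real_complex R)) -rmorphM -rmorphD size_map_poly mulrC polyCN.
    by rewrite mulNr mul_polyC; exact: tau_lead.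
move=> n; apply: (mop_eigen L_pos TK _ _ _ (HP n)).
- by move=> Q; apply: size_act.
- by apply: size_act => // i j; have [[]] := HP n.
- apply: (bochner_op_sym Amat_nil pw (toC_conj sg) (fun i => toC_conj (tau i))) => i.
  by rewrite /c; case: odd; rewrite /RtoC /= oppr0.
Qed.

Hypothesis no_ratio : forall j k, j != k -> forall P1 P2 : {poly C},
  P1 != 0 -> P2 != 0 ->
  toC sg * (P1^`() * P2 - P1 * P2^`()) + (toC (tau j) - toC (tau k)) * P1 * P2 != 0.

Lemma not_darboux (I1 : set R) (w1 : 'I_N -> R -> R) : measurable I1 -> mu I1 != 0%E ->
  (forall i, moment_weight I1 (w1 i)) -> ~ Darboux I1 (diagW w1) I (Wsym a w).
Proof.
move=> mI1 I1_pos mw1 [P [Q [HP [HQ [E [E' [F [F' [Cn [Cn' H]]]]]]]]]].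
have {H} [_ [_ [uF [_ [[n0 uC] [_ [eq _]]]]]]] := H.
rewrite diagW_poly in HP; have [mP oP] := proj1 (is_MOP_E mI1 mw1 _ _) HP.
rewrite Wsym_poly in HQ; have [mQ oQ] := proj1 (is_MOP_E mI mw _ _) HQ.
have om_pos i : posdef (momL I1 w1 i) := mom_posdef mI1 (mw1 i) I1_pos.
have om_herm i : hermitian (momL I1 w1 i) := @mom_hermitian R I1 (w1 i).
have h0 : (0 < N)%N by exact: ltnW.
(* The nonzero entry of [A] is the one at [(0, 1)], namely [a 1]; it exists because [2 <= N]. *)
apply: (@darboux_false R N A Amat_nil (momL I1 w1) L (toC sg) (fun i => toC (tau i))
  om_pos om_herm L_pos pw _ no_ratio P Q Cn E F (Ordinal h0) (Ordinal hN) n0).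
- by rewrite map_poly_eq0.
- rewrite mxE /=; apply/eqP => -[] /eqP; apply/negP/ha; exact: hN.
- exact: (mop_of_seq om_herm mP oP).
- exact: (mop_of_seq L_herm mQ oQ).
- by [].
- exact: eq.
- exact: uC.
Qed.

Lemma thm_concl_intro :
  (forall (I1 : set R) (W1 : R -> 'M[C]_N), classical_sum I1 W1 ->
     exists w1, [/\ measurable I1, mu I1 != 0%E, forall i, moment_weight I1 (w1 i) &
       W1 = diagW w1]) ->
  thm_concl I (Wsym a w).
Proof.
move=> H; split; first exact: bochner_solution.
by move=> I1 W1 /H [w1 [mI1 I1_pos mw1 ->]]; exact: not_darboux.
Qed.
End Assembly.

(** * Hermite, Laguerre and Jacobi weights *)

Section Weights.
Local Open Scope classical_set_scope.
Variable R : realType.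
Local Notation mu := (@lebesgue_measure R).

Lemma is_derive_continuous (f : R -> R) (x df : R) :
  is_derive x 1 f df -> {for x, continuous f}.
Proof.
by case=> df1 _; apply: differentiable_continuous; apply/derivable1_diffP.
Qed.

Lemma exhaustion_lebesgue_neq0 (I : set R) a b : exhaustion I a b -> mu I != 0%E.
Proof.
move=> exh; have ab := exh_lt exh 0.
have sub : `[a 0%N, b 0%N] `<=` I.
  by move=> x /=; rewrite in_itv /=; exact: exh_sub exh _ _.
apply/eqP => I0; have : mu `[a 0%N, b 0%N] = 0%E.
  apply: (@subset_measure0 _ _ _ mu _ _ _ _ sub) => //.
  exact: exhaustion_measurable exh.
by rewrite lebesgue_measure_itv /= lte_fin ab -EFinB => -[] /eqP; rewrite subr_eq0 gt_eqF.
Qed.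

(** The moments are dominated by the derivative [g] of a bounded function [G], so no improper
    integral has to be evaluated. *)
Lemma dominated_moment_weight (I : set R) a b (w w' g G : R -> R) M :
  exhaustion I a b -> (forall x, I x -> 0 < w x) ->
  (forall x, I x -> is_derive x 1 w (w' x)) ->
  (forall x, I x -> is_derive x 1 G (g x)) ->
  (forall x, I x -> {for x, continuous g}) ->
  (forall x, I x -> 0 <= g x) -> (forall x, I x -> `|G x| <= M) ->
  (forall k, exists c, forall x, I x -> `|x| ^+ k * w x <= c * g x) ->
  moment_weight I w.
Proof.
move=> exh w0 dw dG cg g0 GM bnd; split => // k; have [c cP] := bnd k.
have mI := exhaustion_measurable exh.
have ig : mu.-integrable I (EFin \o g).
  exact: (exhaustion_ge0_integrable exh dG cg g0 GM).
have icg : mu.-integrable I (EFin \o (fun x => c * g x)).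
  by rewrite (_ : _ \o _ = fun x => c%:E * (EFin \o g) x)%E //; exact: integrableZl.
apply: le_integrable icg => //.
  apply/measurable_EFinP; apply: (exhaustion_measurable_fun exh) => x Ix.
  apply: cvgM; first exact: exprn_continuous.
  exact: is_derive_continuous (dw x Ix).
move=> x Ix /=; rewrite lee_fin normrM normrX (gtr0_norm (w0 x Ix)).
exact: le_trans (cP x Ix) (ler_norm _).
Qed.

Lemma squeeze0 (u v : nat -> R) c : (forall n, `|u n| <= c * v n) ->
  v n @[n --> \oo] --> 0 -> u n @[n --> \oo] --> 0.
Proof.
move=> uv v0; apply/norm_cvg0P.
apply: (@squeeze_cvgr _ _ _ _ (fun=> 0) (fun n => c * v n)).
- by apply: nearW => n; rewrite normr_ge0 uv.
- exact: cvg_cst.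
- by rewrite -(mulr0 c); apply: cvgMr.
Qed.

Lemma expR_dominates n (y : R) : 0 <= y -> y ^+ n <= n`!%:R * expR y.
Proof.
case: n => [|n] y0; first by rewrite expr0 fact0 mul1r (le_trans _ (expR_ge1Dx y)) // lerDl.
have := expR_ge1Dxn n y0; rewrite -ler_pdivrMl ?ltr0n ?fact_gt0 //.
by move=> H; rewrite mulrC (le_trans _ H) // lerDr.
Qed.

(** * The Hermite weight *)

Definition hermite_tau (b : R) : {poly R} := (2 * b)%:P + (- 2)%:P * 'X.

Definition nat_seq (n : nat) : R := n.+1%:R.

Lemma exhaustion_H : exhaustion (@I_H R) (fun n => - nat_seq n) nat_seq.
Proof.
split => //.
- by move=> n; rewrite gtrN // ltr0n.
- by move=> n m nm; rewrite lerN2 ler_nat.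
- by move=> n m nm; rewrite ler_nat.
- move=> x _; exists (Num.truncn `|x|); rewrite -ler_norml.
  exact: ltW (truncnS_gt _).
Qed.

Lemma hermite_gt0 (b x : R) : 0 < hermite b x.
Proof. exact: expR_gt0. Qed.

Lemma is_derive_hermite (b x : R) :
  is_derive x 1 (hermite b) ((2 * b - 2 * x) * hermite b x).
Proof.
rewrite /hermite.
have H : is_derive x (1 : R) (fun x => - x ^+ 2 + 2 * b * x) (2 * b - 2 * x).
  have := is_derive_poly ((2 * b)%:P * 'X - 'X ^+ 2) x.
  rewrite (_ : horner _ = fun x => - x ^+ 2 + 2 * b * x); last first.
    by apply/funext => y; rewrite !hornerE; ring.
  move=> H; apply: is_derive_eq H _.
  by rewrite derivB derivM derivC derivX derivXn !hornerE; ring.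
have := is_derive1_comp (is_derive_expR _) H.
by move=> H'; apply: is_derive_eq H' _; rewrite /hermite /GRing.scale /= mulrC.
Qed.

(** The majorant is the derivative of [atan]. With [y = 1 + x^2], the constant combines
    [y^(k+1) <= 2^(k+1) (k+1)! exp (y/2)] with the square completion that bounds the weight by
    [exp (1/2 + 2 b^2) exp (- y/2)]. *)
Lemma hermite_moment_bound (b : R) k : exists c, forall x,
  `|x| ^+ k * hermite b x <= c * (1 + x ^+ 2)^-1.
Proof.
exists (2 ^+ k.+1 * (k.+1)`!%:R * expR (2^-1 + 2 * b ^+ 2)) => x.
set y := 1 + x ^+ 2.
have y0 : 0 < y by rewrite /y ltr_pwDl // sqr_ge0.
have xk : `|x| ^+ k <= y ^+ k.
  apply: lerXn2r; rewrite ?nnegrE ?normr_ge0 ?(ltW y0) //.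
  by rewrite /y -real_normK ?num_real //; nra.
have yk : y ^+ k.+1 <= 2 ^+ k.+1 * ((k.+1)`!%:R * expR (y / 2)).
  have -> : y ^+ k.+1 = 2 ^+ k.+1 * (y / 2) ^+ k.+1.
    by rewrite -exprMn mulrC divfK ?pnatr_eq0.
  by rewrite ler_pM2l ?exprn_gt0 // expR_dominates // divr_ge0 // ltW.
have hb : hermite b x <= expR (2^-1 + 2 * b ^+ 2) * expR (- (y / 2)).
  rewrite -expRD ler_expR /y; have := sqr_ge0 (x - 2 * b); nra.
rewrite ler_pdivlMr // mulrAC.
apply: (@le_trans _ _ (y ^+ k.+1 * (expR (2^-1 + 2 * b ^+ 2) * expR (- (y / 2))))).
  apply: ler_pM => //.
  - by rewrite mulr_ge0 ?exprn_ge0 // ltW.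
  - exact: expR_ge0.
  - by rewrite exprSr ler_pM2r.
apply: (@le_trans _ _ ((2 ^+ k.+1 * ((k.+1)`!%:R * expR (y / 2))) *
   (expR (2^-1 + 2 * b ^+ 2) * expR (- (y / 2))))).
  by rewrite ler_pM2r // mulr_gt0 ?expR_gt0.
rewrite expRN le_eqVlt; apply/orP; left; apply/eqP.
have e0 : expR (y / 2) != 0 by rewrite gt_eqF ?expR_gt0.
by field.
Qed.

Lemma is_derive_cauchy (x : R) : is_derive x 1 (fun x => (1 + x ^+ 2)^-1)
  (- (1 + x ^+ 2) ^- 2 * (2 * x)).
Proof.
have y0 : 1 + x ^+ 2 != 0 by rewrite gt_eqF // ltr_pwDl // sqr_ge0.
pose f (x : R) := 1 + x ^+ 2.
have H : is_derive x (1 : R) f (2 * x).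
  have := is_derive_poly (1 + 'X ^+ 2) x.
  rewrite (_ : horner _ = f); last by apply/funext => y; rewrite !hornerE.
  by move=> H; apply: is_derive_eq H _; rewrite derivD derivXn derivC !hornerE; ring.
have := @is_deriveV _ f x _ _ y0 H.
by move=> H'; apply: is_derive_eq H' _.
Qed.

Lemma hermite_moment_weight (b : R) : moment_weight (@I_H R) (hermite b).
Proof.
apply: (@dominated_moment_weight _ _ _ _ (fun x => (2 * b - 2 * x) * hermite b x)
  (fun x => (1 + x ^+ 2)^-1) atan (pi / 2) exhaustion_H).
- by move=> x _; exact: hermite_gt0.
- by move=> x _; exact: is_derive_hermite.
- by move=> x _; exact: is_derive_continuous (is_derive_cauchy x).
- by move=> x _; rewrite invr_ge0 addr_ge0 // sqr_ge0.
- by move=> x _; rewrite ler_norml !ltW ?atan_gtNpi2 ?atan_ltpi2.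
- by move=> k; have [c H] := hermite_moment_bound b k; exists c => x _.
Qed.

(** The sign [s] treats both ends at once. *)
Lemma hermite_boundary (b : R) k (s : R) : s ^+ 2 = 1 ->
  ((1 : {poly R}).[s * nat_seq n] * ((s * nat_seq n) ^+ k * hermite b (s * nat_seq n)))
    @[n --> \oo] --> 0.
Proof.
move=> s1; have [c cP] := hermite_moment_bound b k.
apply: (@squeeze0 _ harmonic `|c|); last exact: cvg_harmonic.
move=> n; rewrite hornerC mul1r normrM normrX (gtr0_norm (hermite_gt0 _ _)).
apply: le_trans (cP _) _; rewrite exprMn s1 mul1r.
have h0 : 0 < nat_seq n by rewrite ltr0n.
have h1 : 1 <= nat_seq n by rewrite ler1n.
apply: (@le_trans _ _ (`|c| * (1 + nat_seq n ^+ 2)^-1)).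
  by rewrite ler_wpM2r ?ler_norm // invr_ge0 addr_ge0 // sqr_ge0.
rewrite ler_wpM2l // /harmonic -/(nat_seq n) lef_pV2 ?posrE //; first by nra.
by rewrite ltr_pwDl // sqr_ge0.
Qed.

Lemma hermite_pearson (b : R) :
  pearson (map_poly (real_complex R) 1) (map_poly (real_complex R) (hermite_tau b))
    (mom (@I_H R) (hermite b)).
Proof.
apply: (mom_pearson exhaustion_H (hermite_moment_weight b)
  (w' := fun x => (2 * b - 2 * x) * hermite b x)).
- by move=> x _; exact: is_derive_hermite.
- by move=> x _; rewrite -polyC1 derivC /hermite_tau !hornerE; ring.
- move=> k; have := hermite_boundary b k (s := -1); rewrite sqrrN expr1n => /(_ erefl).
  by under eq_fun do rewrite mulN1r.
- move=> k; have := hermite_boundary b k (s := 1); rewrite expr1n => /(_ erefl).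
  by under eq_fun do rewrite mul1r.
Qed.

Lemma is_derive_powR_comp (f : R -> R) (p x df : R) : is_derive x 1 f df -> 0 < f x ->
  is_derive x 1 (fun y => f y `^ p) (p * f x `^ (p - 1) * df).
Proof. by move=> H f0; have := is_derive1_comp (is_derive1_powR p f0) H. Qed.

Lemma powRB1 (x p : R) : 0 < x -> x `^ (p - 1) = x `^ p / x.
Proof. by move=> x0; rewrite powRB ?lt0r_neq0 ?implybT // powRr1 // ltW. Qed.

(** The shift by 2 keeps the terms strictly below 1, so that the first interval of the exhaustions
    below is not degenerate. *)
Definition inv_seq (n : nat) : R := n.+2%:R^-1.

Lemma inv_seq_gt0 n : 0 < inv_seq n. Proof. by rewrite invr_gt0 ltr0n. Qed.

Lemma inv_seq_lt1 n : inv_seq n < 1. Proof. by rewrite invf_lt1 ?ltr0n // ltr1n. Qed.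

Lemma inv_seq_le n m : (n <= m)%N -> inv_seq m <= inv_seq n.
Proof. by move=> nm; rewrite lef_pV2 ?posrE ?ltr0n // ler_nat !ltnS. Qed.

Lemma inv_seq_small (x : R) : 0 < x -> exists n, forall m, (n <= m)%N -> inv_seq m <= x.
Proof.
move=> x0; exists (Num.truncn x^-1) => m nm.
rewrite -[x]invrK lef_pV2 ?posrE ?invr_gt0 ?ltr0n //.
by apply: (le_trans (ltW (truncnS_gt _))); rewrite ler_nat ltnS leqW.
Qed.

Lemma inv_seq_powR_cvg0 (p : R) : 0 < p -> inv_seq n `^ p @[n --> \oo] --> (0 : R).
Proof.
move=> p0; have := powR_cvg0 p0 => /cvg_at_rightP /(_ inv_seq); apply; split.
  by move=> n; exact: inv_seq_gt0.
apply: (@squeeze0 _ harmonic 1); last exact: cvg_harmonic.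
move=> n; rewrite mul1r gtr0_norm ?inv_seq_gt0 // lef_pV2 ?posrE ?ltr0n //.
by rewrite ler_nat.
Qed.

(** * The Laguerre weight *)

Definition laguerre_tau (al : R) : {poly R} := (al + 1)%:P + (- 1)%:P * 'X.

Lemma exhaustion_L : exhaustion (@I_L R) inv_seq nat_seq.
Proof.
split.
- by move=> n; rewrite (lt_le_trans (inv_seq_lt1 n)) // ler1n.
- exact: inv_seq_le.
- by move=> n m nm; rewrite ler_nat.
- by move=> n x /andP[h _]; rewrite /I_L /= (lt_le_trans (inv_seq_gt0 n)).
- move=> x x0; have [n nx] := inv_seq_small x0.
  exists (maxn n (Num.truncn x)); rewrite nx ?leq_maxl //=.
  by apply: (le_trans (ltW (truncnS_gt x))); rewrite ler_nat ltnS leq_maxr.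
Qed.

Lemma laguerre_gt0 (al x : R) : 0 < x -> 0 < laguerre al x.
Proof. by move=> x0; rewrite mulr_gt0 ?expR_gt0 ?powR_gt0. Qed.

Lemma is_derive_laguerre (al x : R) : 0 < x ->
  is_derive x 1 (laguerre al) ((al / x - 1) * laguerre al x).
Proof.
move=> x0; have H1 := is_derive1_comp (is_derive_expR (- x)) (is_deriveNid x (1 : R)).
have H2 := is_derive1_powR al x0.
have := is_deriveM H1 H2; move=> H; apply: is_derive_eq H _.
by rewrite /laguerre powRB1 // /GRing.scale /=; ring.
Qed.

Lemma exp_poly_bound n (x : R) : 0 <= x ->
  (1 + x) ^+ n * expR (- x) <= n`!%:R * expR 1.
Proof.
move=> x0; rewrite expRN ler_pdivrMr ?expR_gt0 // -mulrA -expRD.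
by rewrite expR_dominates // addr_ge0.
Qed.

Lemma powR_le_exprn (al y : R) : 1 <= y -> y `^ al <= y ^+ (Num.truncn `|al|).+1.
Proof.
move=> y1; rewrite -powR_mulrn ?(le_trans ler01) // ler_powR //.
exact: le_trans (ler_norm _) (ltW (truncnS_gt _)).
Qed.

(** The substitution [u = x / (1 + x)], with [du = v^2 dx], maps the half-line to [(0, 1)]. The
    majorant [u^al v^2] has the bounded antiderivative [u^(al+1) / (al+1)] and carries the
    singularity at 0. *)
Lemma laguerre_moment_weight (al : R) : -1 < al -> moment_weight (@I_L R) (laguerre al).
Proof.
move=> al1; have al0 : 0 < al + 1 by rewrite -ltrBlDr sub0r.
pose v (x : R) := (1 + x)^-1; pose u (x : R) := 1 - v x.
have vx0 (x : R) : 0 < x -> 0 < 1 + x by move=> x0; rewrite addr_gt0.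
have dv (x : R) : 0 < x -> is_derive x 1 v (- v x ^+ 2).
  move=> x0; have H : is_derive x (1 : R) (fun x => 1 + x) 1.
    have := is_derive_poly (1 + 'X) x.
    rewrite (_ : horner _ = fun x => 1 + x); last by apply/funext => y; rewrite !hornerE.
    by move=> H; apply: is_derive_eq H _; rewrite derivD derivX derivC !hornerE.
  have := @is_deriveV _ (fun x => 1 + x) x _ _ (lt0r_neq0 (vx0 x x0)) H.
  by move=> H'; apply: is_derive_eq H' _; rewrite /GRing.scale /= mulr1 /v exprVn.
have du (x : R) : 0 < x -> is_derive x 1 u (v x ^+ 2).
  move=> x0; have := is_deriveB (is_derive_cst (1 : R) x 1) (dv x x0).
  by move=> H; apply: is_derive_eq H _; rewrite sub0r opprK.
have uE x : 0 < x -> x = u x * (1 + x).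
  by move=> x0; rewrite mulrBl mulVf ?gt_eqF ?vx0 // mul1r addrC addKr.
have u0 x : 0 < x -> 0 < u x by move=> x0; rewrite subr_gt0 invf_lt1 ?vx0 // ltrDl.
apply: (@dominated_moment_weight _ _ _ _ (fun x => (al / x - 1) * laguerre al x)
  (fun x => u x `^ al * v x ^+ 2) (fun x => (al + 1)^-1 * u x `^ (al + 1))
  (al + 1)^-1 exhaustion_L).
- by move=> x; exact: laguerre_gt0.
- by move=> x; exact: is_derive_laguerre.
- move=> x x0; have H := is_derive_powR_comp (al + 1) (du x x0) (u0 x x0).
  have {}H := is_deriveZ (al + 1)^-1 H; apply: is_derive_eq H _; rewrite /GRing.scale /= addrK.
  by rewrite -mulrA mulKf // gt_eqF.
- move=> x x0; apply: cvgM.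
    exact: is_derive_continuous (is_derive_powR_comp al (du x x0) (u0 x x0)).
  have cv := is_derive_continuous (dv x x0).
  by apply: (@cvgM _ _ _ _ v v).
- by move=> x x0; rewrite mulr_ge0 ?powR_ge0 ?sqr_ge0.
- move=> x x0; rewrite ger0_norm ?mulr_ge0 ?powR_ge0 ?invr_ge0 ?(ltW al0) //.
  rewrite ler_piMr ?invr_ge0 ?(ltW al0) //.
  apply: (@le_trans _ _ (1 `^ (al + 1))); last by rewrite powR1.
  apply: ge0_ler_powR; rewrite ?nnegrE ?(ltW al0) ?(ltW (u0 x x0)) //.
  by rewrite lerBlDr lerDl invr_ge0 ltW // vx0.
- move=> k; set m := (Num.truncn `|al|).+1.
  (* Here [m >= |al|] replaces the real power of [1 + x] by a natural one, and the extra 2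
     compensates the factor [v^2]. *)
  exists ((k + m + 2)`!%:R * expR 1) => x x0.
  have xE : x `^ al = u x `^ al * (1 + x) `^ al.
    by rewrite -powRM ?(ltW (u0 x x0)) ?(ltW (vx0 x x0)) // -uE.
  rewrite gtr0_norm // /laguerre xE.
  have y1 : 1 <= 1 + x by rewrite lerDl ltW.
  apply: (@le_trans _ _ ((1 + x) ^+ (k + m + 2) * expR (- x) * (u x `^ al * v x ^+ 2))).
    rewrite !exprD.
    have -> : (1 + x) ^+ k * (1 + x) ^+ m * (1 + x) ^+ 2 * expR (- x) *
        (u x `^ al * v x ^+ 2) = (1 + x) ^+ k * (expR (- x) * (u x `^ al * (1 + x) ^+ m)).
      by rewrite /v; field; rewrite gt_eqF ?vx0.
    apply: ler_pM; rewrite ?exprn_ge0 ?(ltW x0) ?mulr_ge0 ?expR_ge0 ?powR_ge0 //.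
      by rewrite lerXn2r ?nnegrE ?(ltW x0) ?(ltW (vx0 x x0)) // lerDr.
    by rewrite ler_wpM2l ?expR_ge0 // ler_wpM2l ?powR_ge0 // powR_le_exprn.
  apply: ler_wpM2r; first by rewrite mulr_ge0 ?powR_ge0 ?sqr_ge0.
  exact: (exp_poly_bound _ (ltW x0)).
Qed.

Lemma laguerre_pearson (al : R) : -1 < al ->
  pearson (map_poly (real_complex R) 'X) (map_poly (real_complex R) (laguerre_tau al))
    (mom (@I_L R) (laguerre al)).
Proof.
move=> al1; have al0 : 0 < al + 1 by rewrite -ltrBlDr sub0r.
apply: (mom_pearson exhaustion_L (laguerre_moment_weight al1)
  (w' := fun x => (al / x - 1) * laguerre al x)).
- by move=> x; exact: is_derive_laguerre.
- move=> x x0; rewrite derivX -polyC1 /laguerre_tau.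
  rewrite !(hornerD, hornerN, hornerM, hornerC, hornerX).
  by field; rewrite gt_eqF.
(* Near 0 the factor [sg = x] raises the exponent to [al + 1 > 0], while [x^k exp (-x) <= 1]. *)
- move=> k; apply: (@squeeze0 _ (fun n => inv_seq n `^ (al + 1)) 1); last exact: inv_seq_powR_cvg0.
  move=> n; have h0 := inv_seq_gt0 n; have h1 := inv_seq_lt1 n.
  rewrite hornerX !normrM normrX !gtr0_norm ?expR_gt0 ?powR_gt0 // mul1r.
  rewrite -(mulr_powRB1 (ltW h0) al0) addrK ler_wpM2l ?(ltW h0) //.
  rewrite mulrA ler_piMl ?powR_ge0 //.
  rewrite mulr_ile1 ?expR_ge0 ?exprn_ge0 ?exprn_ile1 ?(ltW h0) ?(ltW h1) //.
  by rewrite expR_le1 oppr_le0 ltW.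
(* At infinity one factor [x] comes from [sg] and a second one gains the decay [1 / (n + 1)]; hence
   the exponent [k + m + 2]. *)
- move=> k; set m := (Num.truncn `|al|).+1.
  apply: (@squeeze0 _ harmonic ((k + m + 2)`!%:R * expR 1)); last exact: cvg_harmonic.
  move=> n; have h0 : 0 < nat_seq n by rewrite ltr0n.
  have h1 : 1 <= nat_seq n by rewrite ler1n.
  rewrite hornerX !normrM normrX !gtr0_norm ?expR_gt0 ?powR_gt0 //.
  rewrite /harmonic -/(nat_seq n) ler_pdivlMr //.
  apply: le_trans (exp_poly_bound _ (ltW h0)).
  have hp : nat_seq n `^ al <= nat_seq n ^+ m by exact: powR_le_exprn.
  apply: (@le_trans _ _ (nat_seq n ^+ (k + m + 2) * expR (- nat_seq n))).
    rewrite !exprD.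
    have -> : nat_seq n ^+ k * nat_seq n ^+ m * nat_seq n ^+ 2 * expR (- nat_seq n) =
      nat_seq n * (nat_seq n ^+ k * (expR (- nat_seq n) * nat_seq n ^+ m)) * nat_seq n by ring.
    rewrite ler_wpM2r ?(ltW h0) // ler_wpM2l ?(ltW h0) // ler_wpM2l ?exprn_ge0 ?(ltW h0) //.
    by rewrite ler_wpM2l ?expR_ge0.
  rewrite ler_wpM2r ?expR_ge0 // lerXn2r ?nnegrE ?(ltW h0) ?addr_ge0 ?(ltW h0) //.
  by rewrite lerDr.
Qed.
End Weights.

(** * The Jacobi weight *)

Section JacobiWeight.
Local Open Scope classical_set_scope.
Variable R : realType.

Definition jacobi_sigma : {poly R} := 1 - 'X ^+ 2.

Definition jacobi_tau (al be : R) : {poly R} :=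
  (be - al)%:P + (- (al + be + 2))%:P * 'X.

Lemma exhaustion_J :
  exhaustion (@I_J R) (fun n => -1 + inv_seq R n) (fun n => 1 - inv_seq R n).
Proof.
have h0 := @inv_seq_gt0 R.
have h1 := @inv_seq_lt1 R.
split.
- by move=> n; have := h1 n; lra.
- by move=> n m nm; rewrite lerD2l inv_seq_le.
- by move=> n m nm; rewrite lerD2l lerN2 inv_seq_le.
- move=> n x /andP[k1 k2]; have := h0 n; rewrite /I_J /= => hn.
  by apply/andP; split; lra.
- move=> x /andP[x1 x2].
  have [n nx] : exists n, forall m, (n <= m)%N -> inv_seq R m <= 1 + x.
    by apply: inv_seq_small; lra.
  have [n' nx'] : exists n, forall m, (n <= m)%N -> inv_seq R m <= 1 - x.
    by apply: inv_seq_small; lra.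
  exists (maxn n n'); have := nx _ (leq_maxl n n'); have := nx' _ (leq_maxr n n').
  by move=> k1 k2; apply/andP; split; lra.
Qed.

Lemma is_derive_affine (c s x : R) : is_derive x 1 (fun y => c + s * y) s.
Proof.
have := is_derive_poly (c%:P + s%:P * 'X) x.
rewrite (_ : horner _ = fun y => c + s * y); last first.
  by apply/funext => y; rewrite !hornerE.
by move=> H; apply: is_derive_eq H _; rewrite derivD derivM !derivC derivX !hornerE; ring.
Qed.

Lemma is_derive_1B_powR (p x : R) : x < 1 ->
  is_derive x 1 (fun y => (1 - y) `^ p) (- p * (1 - x) `^ (p - 1)).
Proof.
move=> x1; have H := is_derive_affine 1 (-1) x.
have := is_derive_powR_comp p H; rewrite mulN1r subr_gt0 => /(_ x1).
rewrite (_ : (fun y => _) = fun y : R => (1 - y) `^ p); last first.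
  by apply/funext => y; rewrite mulN1r.
by move=> H'; apply: is_derive_eq H' _; ring.
Qed.

Lemma is_derive_1D_powR (p x : R) : -1 < x ->
  is_derive x 1 (fun y => (1 + y) `^ p) (p * (1 + x) `^ (p - 1)).
Proof.
move=> x1; have H := is_derive_affine 1 1 x.
have x0 : 0 < 1 + x by lra.
have := is_derive_powR_comp p H; rewrite mul1r => /(_ x0).
rewrite (_ : (fun y => _) = fun y : R => (1 + y) `^ p); last first.
  by apply/funext => y; rewrite mul1r.
by move=> H'; apply: is_derive_eq H' _; ring.
Qed.

Lemma jacobi_gt0 (al be x : R) : -1 < x < 1 -> 0 < jacobi al be x.
Proof. by move=> /andP[x1 x2]; rewrite mulr_gt0 // powR_gt0; lra. Qed.

Lemma is_derive_jacobi (al be x : R) : -1 < x < 1 -> is_derive x 1 (jacobi al be)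
  ((be / (1 + x) - al / (1 - x)) * jacobi al be x).
Proof.
move=> /andP[x1 x2]; have := is_deriveM (is_derive_1B_powR al x2) (is_derive_1D_powR be x1).
move=> H; apply: is_derive_eq H _.
rewrite /jacobi !powRB1 ?subr_gt0 //; last by lra.
by rewrite /GRing.scale /=; ring.
Qed.

Lemma powR_le_2 (p y : R) : 1 <= y <= 2 -> y `^ p <= 2 `^ `|p|.
Proof.
move=> /andP[y1 y2]; apply: (@le_trans _ _ (y `^ `|p|)).
  by rewrite ler_powR // ler_norm.
by apply: ge0_ler_powR; rewrite ?nnegrE ?(le_trans ler01 y1).
Qed.

Lemma powR_le_2p (p y : R) : 0 < p -> 0 <= y <= 2 -> y `^ p <= 2 `^ p.
Proof.
move=> p0 /andP[y0 y2].
by apply: ge0_ler_powR; rewrite ?nnegrE // ltW.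
Qed.

(** On each half of the interval one of the two factors has its base in [[1, 2]] and is bounded, so
    only one endpoint can be singular at a time. *)
Lemma jacobi_le (al be x : R) : -1 < x < 1 -> jacobi al be x <=
  (2 `^ `|al| + 2 `^ `|be|) * ((1 - x) `^ al + (1 + x) `^ be).
Proof.
move=> /andP[x1 x2].
have a0 := powR_ge0 (1 - x) al; have b0 := powR_ge0 (1 + x) be.
have A0 := powR_ge0 2 `|al|; have B0 := powR_ge0 2 `|be|.
have [x0|x0] := lerP 0 x.
  have : (1 + x) `^ be <= 2 `^ `|be| by apply: powR_le_2; apply/andP; split; lra.
  by rewrite /jacobi; nra.
have : (1 - x) `^ al <= 2 `^ `|al| by apply: powR_le_2; apply/andP; split; lra.
by rewrite /jacobi; nra.
Qed.

Lemma jacobi_moment_weight (al be : R) : -1 < al -> -1 < be ->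
  moment_weight (@I_J R) (jacobi al be).
Proof.
move=> al1 be1; have al0 : 0 < al + 1 by lra.
have be0 : 0 < be + 1 by lra.
apply: (@dominated_moment_weight _ _ _ _ _
  (fun x => (be / (1 + x) - al / (1 - x)) * jacobi al be x)
  (fun x => (1 - x) `^ al + (1 + x) `^ be)
  (fun x => - (al + 1)^-1 * (1 - x) `^ (al + 1) + (be + 1)^-1 * (1 + x) `^ (be + 1))
  ((al + 1)^-1 * 2 `^ (al + 1) + (be + 1)^-1 * 2 `^ (be + 1)) exhaustion_J).
- by move=> x; exact: jacobi_gt0.
- by move=> x; exact: is_derive_jacobi.
- move=> x /andP[x1 x2].
  have := is_deriveD (is_deriveZ (- (al + 1)^-1) (is_derive_1B_powR (al + 1) x2))
    (is_deriveZ (be + 1)^-1 (is_derive_1D_powR (be + 1) x1)).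
  move=> H; apply: is_derive_eq H _; rewrite /GRing.scale /= !addrK.
  by rewrite mulrA mulrNN mulVf ?gt_eqF // mulrA mulVf ?gt_eqF // !mul1r.
- move=> x /andP[x1 x2]; apply: cvgD.
    exact: is_derive_continuous (is_derive_1B_powR al x2).
  exact: is_derive_continuous (is_derive_1D_powR be x1).
- by move=> x _; rewrite addr_ge0 ?powR_ge0.
- move=> x /andP[x1 x2]; apply: (le_trans (ler_normD _ _)).
  rewrite !normrM normrN !normfV (gtr0_norm al0) (gtr0_norm be0) !ger0_norm ?powR_ge0 //.
  by apply: lerD; rewrite ler_wpM2l ?invr_ge0 ?(ltW al0) ?(ltW be0) // powR_le_2p //;
    apply/andP; split; lra.
- move=> k; exists (2 `^ `|al| + 2 `^ `|be|) => x xI.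
  apply: le_trans (jacobi_le _ _ xI).
  rewrite ler_piMl ?(ltW (jacobi_gt0 _ _ xI)) // exprn_ile1 // ler_norml.
  by move: xI => /andP[x1 x2]; rewrite !ltW.
Qed.

(** Multiplication by [1 - x^2] raises both exponents by one, which makes them positive; the
    boundary terms thereby tend to 0. *)
Lemma jacobi_sigmaM (al be x : R) : -1 < x < 1 ->
  jacobi_sigma.[x] * jacobi al be x = (1 - x) `^ (al + 1) * (1 + x) `^ (be + 1).
Proof.
move=> /andP[x1 x2]; have h1 : 0 < 1 - x by lra.
have h2 : 0 < 1 + x by lra.
rewrite !powRD ?(lt0r_neq0 h1) ?(lt0r_neq0 h2) ?implybT // !powRr1 ?ltW //.
rewrite /jacobi_sigma /jacobi -polyC1 !(hornerD, hornerN, hornerC, hornerX, hornerXn).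
ring.
Qed.

Lemma jacobi_pearson (al be : R) : -1 < al -> -1 < be ->
  pearson (map_poly (real_complex R) jacobi_sigma)
    (map_poly (real_complex R) (jacobi_tau al be)) (mom (@I_J R) (jacobi al be)).
Proof.
move=> al1 be1; have al0 : 0 < al + 1 by lra.
have be0 : 0 < be + 1 by lra.
have bound k x : -1 < x < 1 -> `|jacobi_sigma.[x] * (x ^+ k * jacobi al be x)| <=
    (1 - x) `^ (al + 1) * (1 + x) `^ (be + 1).
  move=> xI; rewrite mulrCA jacobi_sigmaM // normrM.
  rewrite [X in _ * X]ger0_norm ?mulr_ge0 ?powR_ge0 //.
  rewrite ler_piMl ?mulr_ge0 ?powR_ge0 // normrX exprn_ile1 // ler_norml.
  by move: xI => /andP[x1 x2]; rewrite !ltW.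
have h0 := @inv_seq_gt0 R; have h1 := @inv_seq_lt1 R.
apply: (mom_pearson exhaustion_J (jacobi_moment_weight al1 be1)
  (w' := fun x => (be / (1 + x) - al / (1 - x)) * jacobi al be x)).
- by move=> x; exact: is_derive_jacobi.
- move=> x /andP[x1 x2]; rewrite /jacobi_sigma /jacobi_tau derivB derivXn -polyC1 derivC.
  rewrite !(hornerD, hornerN, hornerM, hornerC, hornerX, hornerXn, hornerMn).
  by field; apply/andP; split; rewrite gt_eqF //; lra.
- move=> k; apply: (@squeeze0 _ _ (fun n => inv_seq R n `^ (be + 1)) (2 `^ (al + 1))).
    move=> n; have := h0 n; have := h1 n => k1 k0.
    apply: (le_trans (bound _ _ _)); first by apply/andP; split; lra.
    have -> : 1 + (-1 + inv_seq R n) = inv_seq R n by ring.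
    rewrite ler_wpM2r ?powR_ge0 // powR_le_2p //.
    by apply/andP; split; lra.
  exact: inv_seq_powR_cvg0.
- move=> k; apply: (@squeeze0 _ _ (fun n => inv_seq R n `^ (al + 1)) (2 `^ (be + 1))).
    move=> n; have := h0 n; have := h1 n => k1 k0.
    apply: (le_trans (bound _ _ _)); first by apply/andP; split; lra.
    have -> : 1 - (1 - inv_seq R n) = inv_seq R n by ring.
    rewrite mulrC ler_wpM2r ?powR_ge0 // powR_le_2p //.
    by apply/andP; split; lra.
  exact: inv_seq_powR_cvg0.
Qed.
End JacobiWeight.

(** * Quotients of weights of one family are not rational *)

Section Ratios.
Variable R : realType.
Local Notation C := R[i].
Local Notation toC := (map_poly (real_complex R)).

Lemma RtoC_int (x : R) (k : int) : RtoC x = k%:~R -> x = k%:~R.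
Proof.
move=> H; apply: (fmorph_inj (real_complex R)); rewrite rmorph_int; exact: H.
Qed.

Lemma hermite_no_ratio (b b' : R) (P1 P2 : {poly C}) : b != b' -> P1 != 0 -> P2 != 0 ->
  toC 1 * (P1^`() * P2 - P1 * P2^`()) +
    (toC (hermite_tau b) - toC (hermite_tau b')) * P1 * P2 != 0.
Proof.
move=> bb P10 P20; rewrite -rmorphB rmorph1 mul1r /=.
have -> : hermite_tau b - hermite_tau b' = (2 * (b - b'))%:P.
  by rewrite /hermite_tau mulrBr polyCB; ring.
rewrite map_polyC; apply: no_ratio_deg => //=.
apply/eqP => -[] /eqP; apply/negP; rewrite mulf_neq0 ?subr_eq0 //.
Qed.

Lemma laguerre_no_ratio (al al' : R) (P1 P2 : {poly C}) : not_int (al - al') ->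
  P1 != 0 -> P2 != 0 ->
  toC 'X * (P1^`() * P2 - P1 * P2^`()) +
    (toC (laguerre_tau al) - toC (laguerre_tau al')) * P1 * P2 != 0.
Proof.
move=> ni P10 P20; rewrite -rmorphB /=.
have -> : laguerre_tau al - laguerre_tau al' = (al - al')%:P.
  by rewrite /laguerre_tau polyCB !polyCD; ring.
rewrite map_polyX map_polyC.
have -> : 'X = ('X - 0%:P) * 1%:P :> {poly C} by rewrite polyC0 polyC1 subr0 mulr1.
apply: no_ratio_root => // [|k]; rewrite !hornerC ?oner_neq0 // mul1r.
by apply/eqP => H; apply: ni; exists k; exact: RtoC_int.
Qed.

(** At the root [c] of [1 - x^2 = (x - c) (- (x + c))] the cofactor is [- 2 c] and the difference of
    the [tau] is [- 2 c d], with [d = al - al'] at [c = 1] and [d = be - be'] at [c = -1]. So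
    [no_ratio_root] applies where [d] is not an integer. *)
Lemma jacobi_no_ratio (al be al' be' : R) (P1 P2 : {poly C}) :
  not_int (al - al') \/ not_int (be - be') -> P1 != 0 -> P2 != 0 ->
  toC (jacobi_sigma R) * (P1^`() * P2 - P1 * P2^`()) +
    (toC (jacobi_tau al be) - toC (jacobi_tau al' be')) * P1 * P2 != 0.
Proof.
move=> ni P10 P20; rewrite -rmorphB /=.
set t := jacobi_tau _ _ - _.
have tE x : t.[x] = be - al - (al + be + 2) * x - (be' - al' - (al' + be' + 2) * x).
  by rewrite /t /jacobi_tau !(hornerD, hornerN, hornerM, hornerC, hornerX); ring.
have two : (2 : R) != 0 by rewrite pnatr_eq0.
have sgE (c : R) : c ^+ 2 = 1 ->
    toC (jacobi_sigma R) = ('X - (RtoC c)%:P) * toC (- ('X + c%:P)).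
  move=> c2; have -> : 'X - (RtoC c)%:P = toC ('X - c%:P).
    by rewrite rmorphB /= map_polyX map_polyC.
  rewrite -rmorphM; congr (map_poly _ _); rewrite /jacobi_sigma -polyC1 -c2 polyC_exp.
  ring.
have core (c d : R) : c ^+ 2 = 1 -> not_int d -> t.[c] = - (2 * c) * d ->
    toC (jacobi_sigma R) * (P1^`() * P2 - P1 * P2^`()) + toC t * P1 * P2 != 0.
  move=> c2 nd tc; have c0 : c != 0.
    by apply: contra_eqN c2 => /eqP ->; rewrite expr0n /= eq_sym oner_eq0.
  have sc : (- ('X + c%:P)).[c] = - (2 * c).
    by rewrite !(hornerD, hornerN, hornerX, hornerC); ring.
  rewrite (sgE c c2); apply: no_ratio_root => // [|k].
    rewrite horner_RtoC sc RtoCE fmorph_eq0.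
    by rewrite oppr_eq0 mulf_neq0.
  rewrite !horner_RtoC sc tc; apply/eqP => H; apply: nd; exists k.
  apply: (@mulfI _ (- (2 * c))); first by rewrite oppr_eq0 mulf_neq0.
  apply: (fmorph_inj (real_complex R)); rewrite [RHS]rmorphM /= rmorph_int; exact: H.
case: ni => nd.
  by apply: (core 1 _ _ nd); rewrite ?expr1n // tE; ring.
by apply: (core (-1) _ _ nd); rewrite ?sqrrN ?expr1n // tE; ring.
Qed.

Lemma size_affine (u v : R) : (size (u%:P + v%:P * 'X : {poly R})%R <= 2)%N.
Proof.
rewrite (leq_trans (size_polyD _ _)) // geq_max (leq_trans (size_polyC_leq1 _)) //=.
by rewrite mul_polyC (leq_trans (size_scale_leq _ _)) // size_polyX.
Qed.

Lemma classical_sum_moment (N : nat) (I1 : set R) (W1 : R -> 'M[C]_N) :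
  classical_sum I1 W1 -> exists w1, [/\ measurable I1, lebesgue_measure I1 != 0%E,
    forall i, moment_weight I1 (w1 i) & W1 = diagW w1].
Proof.
case=> [[-> [b ->]]|[[-> [al [al1 ->]]]|[-> [al [be [al1 [be1 ->]]]]]]].
- exists (fun i => hermite (b i)); split=> //.
  + exact: (exhaustion_measurable (exhaustion_H R)).
  + exact: (exhaustion_lebesgue_neq0 (exhaustion_H R)).
  + by move=> i; exact: hermite_moment_weight.
- exists (fun i => laguerre (al i)); split=> //.
  + exact: (exhaustion_measurable (exhaustion_L R)).
  + exact: (exhaustion_lebesgue_neq0 (exhaustion_L R)).
  + by move=> i; exact: laguerre_moment_weight.
- exists (fun i => jacobi (al i) (be i)); split=> //.
  + exact: (exhaustion_measurable (exhaustion_J R)).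
  + exact: (exhaustion_lebesgue_neq0 (exhaustion_J R)).
  + by move=> i; exact: jacobi_moment_weight.
Qed.
End Ratios.

Theorem theorem1p4 (R : realType) (N : nat) (hN : (2 <= N)%N)
  (a : nat -> R) (ha : forall k : nat, (0 < k < N)%N -> a k != 0) :
  (forall b : 'I_N -> R, injective b ->
     thm_concl (@I_H R) (W_H a b)) /\
  (forall al : 'I_N -> R, (forall i, -1 < al i) ->
     (forall i j, i != j -> not_int (al i - al j)) ->
     thm_concl (@I_L R) (W_L a al)) /\
  (forall al be : 'I_N -> R, (forall i, -1 < al i) -> (forall i, -1 < be i) ->
     (forall i j, i != j -> not_int (al i - al j) \/ not_int (be i - be j)) ->
     (forall i j : 'I_N, (i : nat) = 0%N ->
        al i + be i = al j + be j + 1 + (-1) ^+ (j : nat).+1) ->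
     thm_concl (@I_J R) (W_J a al be)).
Proof.
split; [move=> b binj | split => [al al1 al_ni|al be al1 be1 ni sum]].
(* In all three families [e] is the coefficient of [x] in [tau j] for odd [j]. *)
- apply: (thm_concl_intro hN ha (sg := 1) (tau := fun i => hermite_tau (b i)) (e := - 2)).
  + exact: (exhaustion_measurable (exhaustion_H R)).
  + exact: (exhaustion_lebesgue_neq0 (exhaustion_H R)).
  + by move=> i; exact: hermite_moment_weight.
  + by move=> i; exact: hermite_pearson.
  + exact: oner_neq0.
  + by rewrite size_poly1.
  + by move=> i; exact: size_affine.
  + move=> i j _ _.
    have -> : 1 *+ 2 + 'X * (hermite_tau (b j) - hermite_tau (b i)) =
        2%:P + (2 * b j - 2 * b i)%:P * 'X; last exact: size_affine.
    by rewrite /hermite_tau; ring.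
  + by move=> j _; rewrite /hermite_tau -mul_polyC addrK size_polyC_leq1.
  + by move=> j k jk P1 P2; apply: hermite_no_ratio; apply: contra_neq jk; exact: binj.
  + exact: classical_sum_moment.
- apply: (thm_concl_intro hN ha (sg := 'X) (tau := fun i => laguerre_tau (al i)) (e := - 1)).
  + exact: (exhaustion_measurable (exhaustion_L R)).
  + exact: (exhaustion_lebesgue_neq0 (exhaustion_L R)).
  + by move=> i; exact: laguerre_moment_weight.
  + by move=> i; exact: laguerre_pearson.
  + by rewrite -size_poly_eq0 size_polyX.
  + by rewrite size_polyX.
  + by move=> i; exact: size_affine.
  + move=> i j _ _.
    have -> : 'X *+ 2 + 'X * (laguerre_tau (al j) - laguerre_tau (al i)) =
        0%:P + (2 + al j - al i)%:P * 'X; last exact: size_affine.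
    by rewrite /laguerre_tau; ring.
  + by move=> j _; rewrite /laguerre_tau -mul_polyC addrK size_polyC_leq1.
  + by move=> j k jk P1 P2; apply: laguerre_no_ratio; exact: al_ni.
  + exact: classical_sum_moment.
have h0 : (0 < N)%N by exact: ltnW.
pose o := Ordinal h0.
(* With indices from 0, the sum [al i + be i] is constant on even indices and smaller by 2 on odd
   ones. *)
have even_sum (i : 'I_N) : ~~ odd i -> al i + be i = al o + be o.
  by move=> oi; rewrite (sum o i erefl) -signr_odd /= (negPf oi) /= expr1 addrK.
have odd_sum (i : 'I_N) : odd i -> al i + be i + 2 = al o + be o.
  by move=> oi; rewrite (sum o i erefl) -signr_odd /= oi /= expr0; ring.
apply: (thm_concl_intro hN ha (sg := jacobi_sigma R)
  (tau := fun i => jacobi_tau (al i) (be i)) (e := - (al o + be o))).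
- exact: (exhaustion_measurable (exhaustion_J R)).
- exact: (exhaustion_lebesgue_neq0 (exhaustion_J R)).
- by move=> i; exact: jacobi_moment_weight.
- by move=> i; exact: jacobi_pearson.
- apply/eqP => /(congr1 (horner^~ 0)).
  rewrite /jacobi_sigma -polyC1 !(hornerD, hornerN, hornerC, hornerXn) expr0n subr0 => /eqP.
  by rewrite oner_eq0.
- rewrite /jacobi_sigma (leq_trans (size_polyD _ _)) // size_polyN size_polyXn size_poly1.
  by [].
- by move=> i; exact: size_affine.
- move=> i j ei oj.
  have -> : jacobi_sigma R *+ 2 + 'X * (jacobi_tau (al j) (be j) - jacobi_tau (al i) (be i)) =
      2%:P + (be j - al j - (be i - al i))%:P * 'X; last exact: size_affine.
  (* This drop by 2 makes the coefficient of [x^2] in [2 sg + x (tau j - tau i)] vanish. *)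
  have E : al j + be j + 2 = al i + be i by rewrite odd_sum // even_sum.
  by rewrite /jacobi_tau E /jacobi_sigma; ring.
- move=> j oj; rewrite /jacobi_tau odd_sum // -mul_polyC addrK size_polyC_leq1 //.
- by move=> j k jk P1 P2; apply: jacobi_no_ratio; exact: ni.
- exact: classical_sum_moment.
Qed.
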